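(* Suppose that $\sum_{n=0}^\infty a_n^{-1}<\infty$, that $a_n\to\infty$ and $\beta_n\to\beta_\infty$ as $n\to\infty$ with $|\beta_\infty|<1$, and that $(k_n-1)\in\ell^1(\mathbb Z_+)$ and $(\beta_n')\in\ell^1(\mathbb Z_+)$. Then for each of the signs ''$\pm$'' and all $z\in\mathbb C$, the Jacobi equation has a unique solution $f_n^{(\pm)}(z)$ with the asymptotics $$f_n^{(\pm)}(z)=a_n^{-1/2}\Theta_n^{(\pm)}\big(1+o(1)\big),\qquad n\to\infty.$$ These solutions are linked by the relation $f^{(-)}(\bar z)=\overline{f^{(+)}(z)}$ and their Wronskian equals $$\{f^{(+)}(z),f^{(-)}(z)\}=-2i\,\varkappa_\infty^{-1}\sqrt{1-\beta_\infty^2}\neq0,$$ so that the solutions $f^{(+)}_n(z)$ and $f^{(-)}_n(z)$ are linearly independent. For all $n\in\mathbb Z_+$, the functions $f_n^{(\pm)}(z)$ are analytic in $z\in\mathbb C$.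
   Context: $\mathbb Z_+=\{0,1,2,\dots\}$; $a_n>0$ and $b_n\in\mathbb R$ for $n\in\mathbb Z_+$, and $a_{-1}>0$ is an arbitrary fixed number. For a sequence $x_n$ put $x_n'=x_{n+1}-x_n$. Notation: $$\beta_n=-\frac{b_n}{2\sqrt{a_{n-1}a_n}},\quad \varkappa_n=\sqrt{\frac{a_{n+1}}{a_n}},\quad k_n=\frac{\varkappa_{n-1}}{\varkappa_n}=\frac{a_n}{\sqrt{a_{n-1}a_{n+1}}}.$$ The limit $\varkappa_\infty=\lim_{n\to\infty}\varkappa_n$ exists and is finite because $(k_n-1)\in\ell^1(\mathbb Z_+)$. The Jacobi equation is $a_{n-1}u_{n-1}+b_nu_n+a_nu_{n+1}=zu_n$, $n\in\mathbb Z_+$, for sequences $u=(u_n)_{n\ge-1}$. The Wronskian of two solutions $u,v$ is $\{u,v\}=a_n(u_nv_{n+1}-u_{n+1}v_n)$, which does not depend on $n\ge-1$. Fix $N_0$ such that $|\beta_n|<1$ and $|\beta_n|$ is separated from $1$ for $n\ge N_0$, and put, for $n\ge N_0+1$, $$\Theta_n^{(\pm)}=\prod_{m=N_0}^{n-1}\Big(\beta_m\mp i\sqrt{1-\beta_m^2}\Big)=\exp\Big(\mp i\sum_{m=N_0}^{n-1}\arccos\beta_m\Big).$$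
   Formalization: The Wronskian of f^(+) and f^(-) is proved equal to +2i ϰ_∞^{-1} sqrt(1-β_∞^2) instead of -2i ϰ_∞^{-1} sqrt(1-β_∞^2), since the stated definitions of the Wronskian and of Θ^(±) force the plus sign (e.g. a_n = 2^n, b_n = 0). *)

(* Defs.v *)
From Stdlib Require Import Reals ZArith.
From Coquelicot Require Import Coquelicot.

Open Scope R_scope.

(* Sequences (x_n) with n >= -1 or n >= 0 are functions on Z, whose values at
   smaller indices are junk that no statement may depend on. Limits and series
   over n = 0, 1, 2, ... are taken along [on_nat x]. *)
Definition on_nat {T : Type} (x : Z -> T) : nat -> T := fun n => x (Z.of_nat n).

Definition ell1 (x : Z -> R) : Prop := ex_series (fun n => Rabs (on_nat x n)).

Definition diff (x : Z -> R) (n : Z) : R := x (n + 1)%Z - x n.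

Definition beta (a b : Z -> R) (n : Z) : R :=
  - b n / (2 * sqrt (a (n - 1)%Z * a n)).

Definition varkappa (a : Z -> R) (n : Z) : R := sqrt (a (n + 1)%Z / a n).

Definition kcoef (a : Z -> R) (n : Z) : R := varkappa a (n - 1)%Z / varkappa a n.

Definition jacobi_solution (a b : Z -> R) (z : C) (u : Z -> C) : Prop :=
  forall n : Z, (0 <= n)%Z ->
    (RtoC (a (n - 1)%Z) * u (n - 1)%Z + RtoC (b n) * u n + RtoC (a n) * u (n + 1)%Z
     = z * u n)%C.

Definition wronskian (a : Z -> R) (u v : Z -> C) (n : Z) : C :=
  (RtoC (a n) * (u n * v (n + 1)%Z - u (n + 1)%Z * v n))%C.

Inductive pm : Set := Plus | Minus.

Definition sgn (s : pm) : R := match s with Plus => 1 | Minus => -1 end.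

Fixpoint Cprod (x : nat -> C) (k : nat) : C :=
  match k with
  | O => RtoC 1
  | S j => (Cprod x j * x j)%C
  end.

(* The product over N0 <= m < n; note the opposite sign: the superscript (+)
   goes with the factor beta_m - i sqrt (1 - beta_m^2), so that, with [wronskian]
   above, a (+) and a (-) solution have a Wronskian on the positive imaginary axis. *)
Definition Theta (a b : Z -> R) (N0 : nat) (s : pm) (n : nat) : C :=
  Cprod (fun j : nat =>
           let bm := on_nat (beta a b) (N0 + j) in
           (RtoC bm - RtoC (sgn s) * Ci * RtoC (sqrt (1 - bm ^ 2)))%C)
        (n - N0).

Definition has_asymptotics (a b : Z -> R) (N0 : nat) (s : pm) (u : Z -> C) : Prop :=
  exists eps : nat -> C,
    filterlim eps eventually (locally (RtoC 0)) /\
    forall n : nat, (N0 + 1 <= n)%nat ->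
      on_nat u n
      = (RtoC (/ sqrt (on_nat a n)) * Theta a b N0 s n * (RtoC 1 + eps n))%C.

Definition lin_indep (u v : Z -> C) : Prop :=
  forall c d : C,
    (forall n : Z, (-1 <= n)%Z -> (c * u n + d * v n)%C = RtoC 0) ->
    c = RtoC 0 /\ d = RtoC 0.

Definition analytic (g : C -> C) : Prop :=
  forall z0 : C, exists (r : posreal) (c : nat -> C),
    forall z : C, Cmod (z - z0)%C < r ->
      @is_pseries C_AbsRing C_NormedModule c (z - z0)%C (g z).

(* Main.v *)
(** Write [u_n = a_n^(-1/2) y_n]. The Jacobi equation becomes
    [k_n y_(n+1) - 2 (beta_n + z alpha_n) y_n + y_(n-1) = 0], where
    [alpha_n = 1 / (2 sqrt (a_(n-1) a_n))] is summable. With [theta_n] the product of the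
    [zeta_m = beta_m - i sqrt (1 - beta_m^2)], which have modulus one, variation of
    parameters [y_n = theta_n P_n + conj theta_n Q_n],
    [y_(n+1) = theta_(n+1) P_n + conj theta_(n+1) Q_n] gives
    [|P_(n+1) - P_n| + |Q_(n+1) - Q_n| <= d_n (|P_n| + |Q_n|)] with [d_n] summable, so that
    for every solution [P_n] and [Q_n] have limits [P] and [Q]. The Wronskian of two
    solutions is [2 i sqrt (1 - beta_inf^2) / varkappa_inf (P Q' - Q P')]; hence [(P, Q)]
    determines the solution, and [f^(+)], [f^(-)] are the solutions with [(P, Q)] equal to
    [(1, 0)] and [(0, 1)]. They are combinations of the two solutions that are polynomial
    in [z], with the limits [P], [Q] of the latter as coefficients. The same estimate,
    summed over the Taylor coefficients at any [z0], shows that these limits are analytic. *)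

Require Import Defs.
From Stdlib Require Import Reals ZArith Lra Lia.
From Coquelicot Require Import Coquelicot.
Open Scope R_scope.

(** * Summable increments and limits *)

(** [T n] is the sum of the terms from index [n] on. The recursion and the limit zero are what the
    later telescoping arguments use of it. *)
Lemma summable_tail (e : nat -> R) :
  ex_series e ->
  exists T : nat -> R,
    (forall n, T n = e n + T (S n)) /\ is_lim_seq T 0.
Proof.
intros He.
exists (fun n => match n with O => Series e | S m => Series e - sum_n e m end).
split.
- intros [|n].
  + rewrite sum_O; ring.
  + rewrite sum_Sn; unfold plus; simpl; ring.
- apply (is_lim_seq_incr_1 _ 0).
  replace (Finite 0) with (Finite (Series e - Series e)) by (f_equal; ring).
  apply is_lim_seq_minus'; [apply is_lim_seq_const|].
  exact (Series_correct e He).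
Qed.

(** By the recursion [T] does not increase, so each value dominates the limit zero. *)
Lemma tail_nonneg (e T : nat -> R) :
  (forall n, 0 <= e n) -> (forall n, T n = e n + T (S n)) -> is_lim_seq T 0 ->
  forall n, 0 <= T n.
Proof.
intros He HT HL n.
assert (H : forall i, T (i + n)%nat <= T n).
{ induction i as [|i IH]; simpl; [lra|].
  specialize (HT (i + n)%nat); specialize (He (i + n)%nat); lra. }
apply (is_lim_seq_le (fun i => T (i + n)%nat) (fun _ => T n) 0 (T n) H).
- now apply (is_lim_seq_incr_n T n 0).
- apply is_lim_seq_const.
Qed.

(** Since [1 + d n <= exp (d n)], the product [exp (T n) * N n], with [T n] the tail of the series,
    does not increase in [n]; moreover [exp (T n) >= 1]. *)
Lemma gronwall (N d : nat -> R) :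
  ex_series d -> (forall n, 0 <= d n) -> (forall n, 0 <= N n) ->
  (forall n, N (S n) <= (1 + d n) * N n) ->
  forall n, N n <= exp (Series d) * N O.
Proof.
intros Hd d0 N0 H.
destruct (summable_tail d Hd) as [T [HT HL]].
assert (T0 := tail_nonneg d T d0 HT HL).
(* The partial sums telescope to [T O - T (S n)], which tends to [T O]. *)
assert (HT0 : T O = Series d).
{ apply eq_sym, is_series_unique.
  assert (E : forall n, @eq R (sum_n d n) (T O - T (S n))).
  { induction n as [|n IH].
    - rewrite sum_O, (HT O); ring.
    - rewrite sum_Sn, IH, (HT (S n)); unfold plus; simpl; ring. }
  change (is_lim_seq (sum_n d) (T O)).
  apply (is_lim_seq_ext (fun n => T O - T (S n)) (sum_n d)).
  - intros n; now rewrite E.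
  - replace (Finite (T O)) with (Finite (T O - 0)) by (f_equal; ring).
    apply is_lim_seq_minus'; [apply is_lim_seq_const|].
    now apply (is_lim_seq_incr_1 T 0). }
assert (G : forall n, exp (T n) * N n <= exp (T O) * N O).
{ induction n as [|n IH]; [lra|].
  apply Rle_trans with (2 := IH).
  rewrite (HT n), exp_plus.
  assert (E1 := exp_ineq1_le (d n)); assert (E2 := exp_pos (T (S n))).
  specialize (H n); specialize (N0 n).
  assert (N (S n) <= exp (d n) * N n) by nra. nra. }
intros n; rewrite <- HT0; apply Rle_trans with (2 := G n).
assert (E1 := exp_ineq1_le (T n)); specialize (T0 n); specialize (N0 n); nra.
Qed.

Lemma is_lim_seq_of_summable_steps (x e : nat -> R) :
  ex_series e -> (forall n, Rabs (x (S n) - x n) <= e n) ->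
  exists l : R, is_lim_seq x l.
Proof.
intros He H.
destruct (ex_series_le (fun n => x (S n) - x n) e H He) as [l Hl].
exists (l + x O); apply (is_lim_seq_incr_1 x).
apply (is_lim_seq_ext (fun n => sum_n (fun n => x (S n) - x n) n + x O)).
- induction n as [|n IH]; [rewrite sum_O; ring|].
  rewrite sum_Sn; unfold plus; simpl; lra.
- apply is_lim_seq_plus'; [exact Hl|apply is_lim_seq_const].
Qed.

(** * Convergence of complex sequences, expressed by the real sequence of distances *)

Definition Clim (x : nat -> C) (l : C) : Prop :=
  is_lim_seq (fun n => Cmod (x n - l)) 0.

Lemma Clim_le (x : nat -> C) (l : C) (e : nat -> R) :
  (forall n, Cmod (x n - l) <= e n) -> is_lim_seq e 0 -> Clim x l.
Proof.
intros H He.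
apply (is_lim_seq_le_le (fun _ => 0) _ e); auto using is_lim_seq_const.
intros n; split; [apply Cmod_ge_0|apply H].
Qed.

Lemma Clim_ext (x y : nat -> C) (l : C) :
  (forall n, x n = y n) -> Clim x l -> Clim y l.
Proof.
intros H; apply is_lim_seq_ext; intros n; now rewrite H.
Qed.

Lemma Clim_const (l : C) : Clim (fun _ => l) l.
Proof.
apply (Clim_le _ _ (fun _ => 0)); [|apply is_lim_seq_const].
intros _; replace (l - l)%C with (RtoC 0) by ring; rewrite Cmod_0; lra.
Qed.

Lemma Clim_incr_n (x : nat -> C) (k : nat) (l : C) :
  Clim x l <-> Clim (fun n => x (n + k)%nat) l.
Proof.
exact (is_lim_seq_incr_n (fun n => Cmod (x n - l)) k 0).
Qed.

Lemma Clim_plus (x y : nat -> C) (l m : C) :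
  Clim x l -> Clim y m -> Clim (fun n => x n + y n)%C (l + m)%C.
Proof.
intros Hx Hy.
apply (Clim_le _ _ (fun n => Cmod (x n - l) + Cmod (y n - m))).
- intros n; replace (x n + y n - (l + m))%C with ((x n - l) + (y n - m))%C by ring.
  apply Cmod_triangle.
- replace (Finite 0) with (Finite (0 + 0)) by (f_equal; ring).
  now apply is_lim_seq_plus'.
Qed.

Lemma Clim_mult (x y : nat -> C) (l m : C) :
  Clim x l -> Clim y m -> Clim (fun n => x n * y n)%C (l * m)%C.
Proof.
intros Hx Hy.
apply (Clim_le _ _ (fun n => Cmod (x n - l) * Cmod (y n - m)
   + (Cmod l * Cmod (y n - m) + Cmod (x n - l) * Cmod m))).
- intros n.
  replace (x n * y n - (l * m))%C
    with ((x n - l) * (y n - m) + (l * (y n - m) + (x n - l) * m))%C by ring.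
  rewrite <- !Cmod_mult.
  eapply Rle_trans; [apply Cmod_triangle|].
  apply Rplus_le_compat_l, Cmod_triangle.
- replace (Finite 0) with (Finite (0 * 0 + (Cmod l * 0 + 0 * Cmod m)))
    by (f_equal; ring).
  repeat first [apply is_lim_seq_plus' | apply is_lim_seq_mult'
    | apply is_lim_seq_const | assumption].
Qed.

Lemma Clim_scal (c : C) (x : nat -> C) (l : C) :
  Clim x l -> Clim (fun n => c * x n)%C (c * l)%C.
Proof. now apply Clim_mult, Clim_const. Qed.

Lemma Clim_minus (x y : nat -> C) (l m : C) :
  Clim x l -> Clim y m -> Clim (fun n => x n - y n)%C (l - m)%C.
Proof.
intros Hx Hy.
replace (l - m)%C with (l + (-(1)) * m)%C by ring.
apply (Clim_ext (fun n => x n + (-(1)) * y n)%C); [intros n; ring|].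
now apply Clim_plus, Clim_scal.
Qed.

Lemma Clim_bounded_mult_0 (x y : nat -> C) (M : R) :
  (forall n, Cmod (x n) <= M) -> Clim y 0 -> Clim (fun n => x n * y n)%C 0.
Proof.
intros Hx Hy.
apply (Clim_le _ _ (fun n => M * Cmod (y n - 0))).
- intros n; replace (x n * y n - 0)%C with (x n * (y n - 0))%C by ring.
  rewrite Cmod_mult; apply Rmult_le_compat_r; [apply Cmod_ge_0|apply Hx].
- replace (Finite 0) with (Finite (M * 0)) by (f_equal; ring).
  apply is_lim_seq_mult'; [apply is_lim_seq_const|exact Hy].
Qed.

Lemma Cmod_triangle_minus (x y z : C) : Cmod (x - z) <= Cmod (x - y) + Cmod (y - z).
Proof.
replace (x - z)%C with ((x - y) + (y - z))%C by ring; apply Cmod_triangle.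
Qed.

Lemma Cmod_minus_sym (x y : C) : Cmod (x - y) = Cmod (y - x).
Proof. rewrite <- Cmod_opp; f_equal; ring. Qed.

(** Subtraction shows that the zero sequence tends to [l - m]; its distances to [l - m] are
    constant, hence zero. *)
Lemma Clim_unique (x : nat -> C) (l m : C) : Clim x l -> Clim x m -> l = m.
Proof.
intros Hl Hm.
assert (H := Clim_minus _ _ _ _ Hl Hm).
assert (E : Cmod (0 - (l - m)) = 0).
{ assert (U : is_lim_seq (fun n => Cmod (x n - x n - (l - m))) (Cmod (0 - (l - m)))).
  { apply (is_lim_seq_ext (fun _ => Cmod (0 - (l - m)))); [|apply is_lim_seq_const].
    intros n; do 2 f_equal; ring. }
  assert (V := is_lim_seq_unique _ _ H); apply is_lim_seq_unique in U.
  apply Rbar_finite_eq; rewrite <- U; exact V. }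
apply Cmod_eq_0 in E.
replace l with (m - (0 - (l - m)))%C by ring; rewrite E; ring.
Qed.

Lemma Clim_Cmod (x : nat -> C) (l : C) :
  Clim x l -> is_lim_seq (fun n => Cmod (x n)) (Cmod l).
Proof.
intros H.
apply (is_lim_seq_le_le (fun n => Cmod l - Cmod (x n - l)) _
                        (fun n => Cmod l + Cmod (x n - l))).
- intros n.
  assert (A := Cmod_triangle_minus l (x n) 0).
  assert (B := Cmod_triangle_minus (x n) l 0).
  replace (x n - 0)%C with (x n) in * by ring.
  replace (l - 0)%C with l in * by ring.
  rewrite (Cmod_minus_sym l) in A; lra.
- replace (Finite (Cmod l)) with (Finite (Cmod l - 0)) by (f_equal; ring).
  apply is_lim_seq_minus'; [apply is_lim_seq_const|exact H].
- replace (Finite (Cmod l)) with (Finite (Cmod l + 0)) by (f_equal; ring).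
  apply is_lim_seq_plus'; [apply is_lim_seq_const|exact H].
Qed.

Lemma Clim_components (x : nat -> C) (l : C) :
  is_lim_seq (fun n => Re (x n)) (Re l) -> is_lim_seq (fun n => Im (x n)) (Im l) ->
  Clim x l.
Proof.
intros Hr Hi.
apply (Clim_le _ _ (fun n => Rabs (Re (x n) - Re l) + Rabs (Im (x n) - Im l))).
- intros n; set (c := (x n - l)%C).
  replace c with (RtoC (Re c) + Ci * RtoC (Im c))%C
    by (destruct c; unfold RtoC, Ci, Cplus, Cmult; simpl; f_equal; ring).
  eapply Rle_trans; [apply Cmod_triangle|].
  rewrite Cmod_mult, Cmod_Ci, !Cmod_R, Rmult_1_l; apply Rle_refl.
- replace (Finite 0) with (Finite (0 + 0)) by (f_equal; ring).
  apply is_lim_seq_plus';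
    apply (is_lim_seq_abs_0 (fun n => _ - _));
    [replace (Finite 0) with (Finite (Re l - Re l)) by (f_equal; ring)
    |replace (Finite 0) with (Finite (Im l - Im l)) by (f_equal; ring)];
    apply is_lim_seq_minus'; auto using is_lim_seq_const.
Qed.

Lemma Clim_RtoC (x : nat -> R) (l : R) :
  is_lim_seq x l -> Clim (fun n => RtoC (x n)) (RtoC l).
Proof.
intros H; apply Clim_components; simpl; [exact H|apply is_lim_seq_const].
Qed.

(** A total operator, taken on real and imaginary parts, so that limits depending on a parameter are
    functions of it; its value is meaningful once convergence is known. *)
Definition clim (x : nat -> C) : C :=
  (real (Lim_seq (fun n => Re (x n))), real (Lim_seq (fun n => Im (x n)))).

Lemma Clim_of_summable_steps (x : nat -> C) (e : nat -> R) :
  ex_series e -> (forall n, Cmod (x (S n) - x n) <= e n) -> Clim x (clim x).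
Proof.
intros He H.
apply Clim_components; simpl.
- destruct (is_lim_seq_of_summable_steps (fun n => Re (x n)) e He) as [l Hl].
  + intros n; apply Rle_trans with (2 := H n).
    exact (re_le_Cmod (x (S n) - x n)%C).
  + now rewrite (is_lim_seq_unique _ _ Hl).
- destruct (is_lim_seq_of_summable_steps (fun n => Im (x n)) e He) as [l Hl].
  + intros n; apply Rle_trans with (2 := H n).
    exact (Rle_trans _ _ _ (Rmax_r _ _) (Rmax_Cmod (x (S n) - x n)%C)).
  + now rewrite (is_lim_seq_unique _ _ Hl).
Qed.

(** Translates the filter formulation of [has_asymptotics] and of power series into [Clim]. *)
Lemma filterlim_C_iff (x : nat -> C) (l : C) :
  @filterlim nat C x eventually (@locally C_UniformSpace l) <-> Clim x l.
Proof.
transitivity (forall eps : posreal, eventually (fun n => Cmod (x n - l) < eps)).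
- exact (@filterlim_locally_ball_norm C_AbsRing nat C_NormedModule eventually
           _ x l).
- unfold Clim; rewrite <- is_lim_seq_spec; simpl.
  split; intros H eps; destruct (H eps) as [N HN]; exists N; intros n Hn;
    specialize (HN n Hn); rewrite Rminus_0_r, Rabs_pos_eq in *;
    auto using Cmod_ge_0.
Qed.

(** * Finite sums over coefficient indices and partial sums of power series *)

Lemma Clim_sum_Cmod (p : nat -> nat -> C) (q c : nat -> C) (J : nat) :
  (forall j, Clim (fun n => p n j) (q j)) ->
  is_lim_seq (fun n => sum_n (fun j => Cmod (p n j - c j)) J)
             (sum_n (fun j => Cmod (q j - c j)) J).
Proof.
intros H.
assert (G : forall j, is_lim_seq (fun n => Cmod (p n j - c j)) (Cmod (q j - c j))).
{ intros j; apply (Clim_Cmod (fun n => p n j - c j)%C), Clim_minus;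
    [apply H|apply Clim_const]. }
induction J as [|J IH].
- rewrite sum_O; eapply is_lim_seq_ext; [|apply (G O)].
  intros n; now rewrite sum_O.
- rewrite sum_Sn; eapply is_lim_seq_ext;
    [|exact (is_lim_seq_plus' _ _ _ _ IH (G (S J)))].
  intros n; now rewrite sum_Sn.
Qed.

Lemma sum_n_le (u v : nat -> R) (J : nat) :
  (forall j, u j <= v j) -> sum_n u J <= sum_n v J.
Proof.
intros H; induction J as [|J IH]; [rewrite !sum_O; apply H|].
rewrite !sum_Sn; unfold plus; simpl; specialize (H (S J)); lra.
Qed.

Lemma sum_n_plus_R (u v : nat -> R) (J : nat) :
  sum_n (fun j => u j + v j) J = sum_n u J + sum_n v J.
Proof. exact (sum_n_plus u v J). Qed.

Lemma sum_n_scal_R (c : R) (u : nat -> R) (J : nat) :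
  sum_n (fun j => c * u j) J = c * sum_n u J.
Proof. exact (sum_n_mult_l (K := R_Ring) c u J). Qed.

Lemma sum_n_nonneg (u : nat -> R) (J : nat) :
  (forall j, 0 <= u j) -> 0 <= sum_n u J.
Proof.
intros H; induction J as [|J IH]; [rewrite sum_O; apply H|].
rewrite sum_Sn; unfold plus; simpl; specialize (H (S J)); lra.
Qed.

Definition pseries_partial (c : nat -> C) (t : C) (J : nat) : C :=
  @sum_n C_NormedModule (fun k => scal (pow_n (K := C_AbsRing) t k) (c k)) J.

Lemma pseries_partial_S (c : nat -> C) (t : C) (J : nat) :
  pseries_partial c t (S J)
  = (pseries_partial c t J + pow_n (K := C_AbsRing) t (S J) * c (S J))%C.
Proof. exact (@sum_Sn C_NormedModule _ J). Qed.

Lemma is_pseries_C_iff (c : nat -> C) (t l : C) :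
  @is_pseries C_AbsRing C_NormedModule c t l <-> Clim (pseries_partial c t) l.
Proof. exact (filterlim_C_iff (pseries_partial c t) l). Qed.

(** In the closed unit disc all powers of [t] have modulus at most one, so the [l1] distance of the
    coefficients controls every partial sum uniformly. *)
Lemma Cmod_pseries_partial_le (c d : nat -> C) (t : C) (J : nat) :
  Cmod t <= 1 ->
  Cmod (pseries_partial c t J - pseries_partial d t J)
  <= sum_n (fun j => Cmod (c j - d j)) J.
Proof.
intros Ht.
assert (H : forall k, Cmod (pow_n (K := C_AbsRing) t k) <= 1).
{ induction k as [|k IH]; simpl.
  - change (Cmod 1 <= 1); rewrite Cmod_1; lra.
  - change (Cmod (t * pow_n (K := C_AbsRing) t k) <= 1); rewrite Cmod_mult.
    assert (A := Cmod_ge_0 t).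
    assert (B := Cmod_ge_0 (pow_n (K := C_AbsRing) t k)); nra. }
assert (G : forall k, Cmod (pow_n (K := C_AbsRing) t k * c k
                     - pow_n (K := C_AbsRing) t k * d k) <= Cmod (c k - d k)).
{ intros k.
  replace (pow_n (K := C_AbsRing) t k * c k - pow_n (K := C_AbsRing) t k * d k)%C
    with (pow_n (K := C_AbsRing) t k * (c k - d k))%C by ring.
  rewrite Cmod_mult; specialize (H k).
  assert (A := Cmod_ge_0 (c k - d k)); nra. }
induction J as [|J IH].
- unfold pseries_partial; rewrite !sum_O; apply (G O).
- rewrite !pseries_partial_S, sum_Sn.
  match goal with |- Cmod ?x <= _ => replace x with
   ((pseries_partial c t J - pseries_partial d t J)
     + (pow_n (K := C_AbsRing) t (S J) * c (S J)
        - pow_n (K := C_AbsRing) t (S J) * d (S J)))%C by ring end.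
  eapply Rle_trans; [apply Cmod_triangle|].
  apply Rplus_le_compat; [exact IH|apply G].
Qed.

(** * Power series whose coefficient sequences have summable [l1] increments *)

Section UniformCoefficients.

Variables (p : nat -> nat -> C) (e : nat -> R).
Hypothesis He : ex_series e.
Hypothesis Hp : forall n J, sum_n (fun j => Cmod (p (S n) j - p n j)) J <= e n.

Lemma coefficient_limit (j : nat) : Clim (fun n => p n j) (clim (fun n => p n j)).
Proof.
apply (Clim_of_summable_steps _ e He); intros n.
apply Rle_trans with (2 := Hp n j).
destruct j as [|j]; [rewrite sum_O; apply Rle_refl|].
rewrite sum_Sn; unfold plus; simpl.
assert (0 <= sum_n (fun j => Cmod (p (S n) j - p n j)) j)
  by (apply sum_n_nonneg; intros; apply Cmod_ge_0).
lra.
Qed.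

(** Telescoping bounds the distance from [p (i + n)] to [p n] by [T n - T (i + n)]; then [i] tends
    to infinity in a sum over finitely many [j]. The bound does not depend on [J]. *)
Lemma coefficient_tail (T : nat -> R) (n J : nat) :
  (forall n, T n = e n + T (S n)) -> is_lim_seq T 0 ->
  sum_n (fun j => Cmod (clim (fun n => p n j) - p n j)) J <= T n.
Proof.
intros HT HL.
assert (T0 : forall n, 0 <= T n).
{ apply (tail_nonneg e); auto; intros m; apply Rle_trans with (2 := Hp m O).
  apply sum_n_nonneg; intros; apply Cmod_ge_0. }
assert (H : forall i,
  sum_n (fun j => Cmod (p (i + n)%nat j - p n j)) J <= T n - T (i + n)%nat).
{ induction i as [|i IH].
  - simpl. replace (T n - T n) with (0 * sum_n (fun _ => 0) J) by ring.
    rewrite <- sum_n_scal_R; apply sum_n_le; intros j.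
    replace (p n j - p n j)%C with (RtoC 0) by ring; rewrite Cmod_0; lra.
  - change (S i + n)%nat with (S (i + n)).
    specialize (Hp (i + n)%nat J); specialize (HT (i + n)%nat).
    assert (A : sum_n (fun j => Cmod (p (S (i + n)) j - p n j)) J <=
      sum_n (fun j => Cmod (p (S (i + n)) j - p (i + n)%nat j)
                      + Cmod (p (i + n)%nat j - p n j)) J)
      by (apply sum_n_le; intros; apply Cmod_triangle_minus).
    rewrite sum_n_plus_R in A; simpl in *; lra. }
apply (is_lim_seq_le (fun i => sum_n (fun j => Cmod (p (i + n)%nat j - p n j)) J)
  (fun _ => T n) (sum_n (fun j => Cmod (clim (fun n => p n j) - p n j)) J) (T n)).
- intros i; specialize (H i); specialize (T0 (i + n)%nat); lra.
- apply (Clim_sum_Cmod (fun i j => p (i + n)%nat j)); intros j.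
  apply (Clim_incr_n (fun m => p m j)), coefficient_limit.
- apply is_lim_seq_const.
Qed.

(** A three-epsilon argument: the partial sums for [p n] and for the limit coefficients differ by at
    most [T n], uniformly in their length. *)
Lemma is_pseries_limit (g : nat -> C) (t l : C) :
  Cmod t <= 1 ->
  (forall n, @is_pseries C_AbsRing C_NormedModule (p n) t (g n)) ->
  Clim g l ->
  @is_pseries C_AbsRing C_NormedModule (fun j => clim (fun n => p n j)) t l.
Proof.
intros Ht Hg Hl.
destruct (summable_tail e He) as [T [HT HL]].
apply is_pseries_C_iff.
apply is_lim_seq_spec; intros eps; simpl.
assert (e3 : 0 < eps / 3) by (destruct eps; simpl; lra).
destruct (proj2 (is_lim_seq_spec _ _) HL (mkposreal _ e3)) as [N1 H1].
apply is_lim_seq_spec in Hl; destruct (Hl (mkposreal _ e3)) as [N2 H2].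
(* [n] is fixed first, making the tail and the distance of [g n] to [l] small; only then is the
   length [J] chosen, depending on [n]. *)
set (n := max N1 N2).
specialize (H1 n (Nat.le_max_l _ _)); specialize (H2 n (Nat.le_max_r _ _)).
simpl in H1, H2; rewrite Rminus_0_r in H1, H2.
specialize (Hg n); apply is_pseries_C_iff, is_lim_seq_spec in Hg.
destruct (Hg (mkposreal _ e3)) as [J0 HJ]; simpl in HJ.
exists J0; intros J HJ0; specialize (HJ J HJ0); rewrite Rminus_0_r in *.
rewrite !Rabs_pos_eq in * by apply Cmod_ge_0.
set (q := fun j => clim (fun n => p n j)) in *.
assert (B := coefficient_tail T n J HT HL).
assert (D := Cmod_pseries_partial_le q (p n) t J Ht).
set (u := pseries_partial q t J) in *.
set (v := pseries_partial (p n) t J) in *.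
assert (E1 := Cmod_triangle_minus u v l).
assert (E2 := Cmod_triangle_minus v (g n) l).
assert (E3 := Rle_abs (T n)).
change (sum_n (fun j => Cmod (q j - p n j)) J <= T n) in B.
lra.
Qed.

End UniformCoefficients.

(** * Variation of parameters *)

Definition opp_pm (s : pm) : pm := match s with Plus => Minus | Minus => Plus end.

Lemma opp_pmK (s : pm) : opp_pm (opp_pm s) = s.
Proof. now destruct s. Qed.

(** The factor of [Theta], that is [exp (-i arccos x)] for [Plus] and its conjugate for [Minus] when
    [Rabs x <= 1]. *)
Definition zeta (s : pm) (x : R) : C :=
  (RtoC x - RtoC (sgn s) * Ci * RtoC (sqrt (1 - x ^ 2)))%C.

Lemma zetaE (s : pm) (x : R) : zeta s x = (x, - sgn s * sqrt (1 - x ^ 2)).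
Proof.
apply injective_projections; unfold zeta; simpl; ring.
Qed.

Lemma zeta_conj (s : pm) (x : R) : Cconj (zeta s x) = zeta (opp_pm s) x.
Proof.
rewrite !zetaE; destruct s; apply injective_projections; simpl; ring.
Qed.

Lemma zeta_mul_opp (s : pm) (x : R) :
  Rabs x <= 1 -> (zeta s x * zeta (opp_pm s) x)%C = RtoC 1.
Proof.
intros Hx.
assert (H : sqrt (1 - x ^ 2) * sqrt (1 - x ^ 2) = 1 - x ^ 2).
{ apply sqrt_sqrt; apply Rabs_le_between in Hx; nra. }
rewrite !zetaE; destruct s; apply injective_projections;
  simpl in *; ring_simplify; nra.
Qed.

Lemma zeta_add_opp (s : pm) (x : R) :
  (zeta s x + zeta (opp_pm s) x)%C = (2 * RtoC x)%C.
Proof.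
rewrite !zetaE; destruct s; apply injective_projections; simpl; ring.
Qed.

Lemma zeta_sub_opp (s : pm) (x : R) :
  (zeta s x - zeta (opp_pm s) x)%C = (- (2 * Ci * RtoC (sgn s * sqrt (1 - x ^ 2))))%C.
Proof.
rewrite !zetaE; destruct s; apply injective_projections; simpl; ring.
Qed.

Lemma Cmod_zeta (s : pm) (x : R) : Rabs x <= 1 -> Cmod (zeta s x) = 1.
Proof.
intros Hx.
assert (H := zeta_mul_opp s x Hx).
rewrite <- zeta_conj in H.
apply (f_equal Cmod) in H; rewrite Cmod_mult, Cmod_conj, Cmod_1 in H.
assert (A := Cmod_ge_0 (zeta s x)); nra.
Qed.

Lemma Cmod_zeta_sub_opp (s : pm) (x : R) :
  Cmod (zeta s x - zeta (opp_pm s) x) = 2 * sqrt (1 - x ^ 2).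
Proof.
rewrite zeta_sub_opp, Cmod_opp, !Cmod_mult, Cmod_Ci, !Cmod_R, Rabs_mult.
rewrite (Rabs_pos_eq (sqrt _)) by apply sqrt_pos.
rewrite (Rabs_pos_eq 2) by lra.
replace (Rabs (sgn s)) with 1; [ring|].
destruct s; simpl; unfold Rabs; destruct (Rcase_abs _); lra.
Qed.

(** The square roots [u], [v] satisfy [(u - v) (u + v) = y^2 - x^2], where [u + v] is at least
    [2 sqrt (1 - q^2)] and [Rabs (x + y) <= 2]; this gives the Lipschitz constant. *)
Lemma Cmod_zeta_sub (s : pm) (q x y : R) :
  q < 1 -> Rabs x <= q -> Rabs y <= q ->
  Cmod (zeta s x - zeta s y) <= Rabs (x - y) * (1 + / sqrt (1 - q ^ 2)).
Proof.
intros Hq Hx Hy.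
assert (q0 : 0 <= q) by (apply Rle_trans with (2 := Hx), Rabs_pos).
set (r := sqrt (1 - q ^ 2)).
assert (r0 : 0 < r) by (apply sqrt_lt_R0; nra).
replace (zeta s x - zeta s y)%C with
  (RtoC (x - y) + RtoC (- sgn s) * Ci
    * RtoC (sqrt (1 - x ^ 2) - sqrt (1 - y ^ 2)))%C
  by (rewrite !zetaE; apply injective_projections; simpl; ring).
eapply Rle_trans; [apply Cmod_triangle|].
rewrite !Cmod_mult, Cmod_Ci, !Cmod_R.
replace (Rabs (- sgn s)) with 1
  by (destruct s; simpl; unfold Rabs; destruct (Rcase_abs _); lra).
assert (Sx : r <= sqrt (1 - x ^ 2)).
{ apply sqrt_le_1_alt; apply Rabs_le_between in Hx; nra. }
assert (Sy : r <= sqrt (1 - y ^ 2)).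
{ apply sqrt_le_1_alt; apply Rabs_le_between in Hy; nra. }
assert (Ex : sqrt (1 - x ^ 2) * sqrt (1 - x ^ 2) = 1 - x ^ 2).
{ apply sqrt_sqrt; apply Rabs_le_between in Hx; nra. }
assert (Ey : sqrt (1 - y ^ 2) * sqrt (1 - y ^ 2) = 1 - y ^ 2).
{ apply sqrt_sqrt; apply Rabs_le_between in Hy; nra. }
set (u := sqrt (1 - x ^ 2)) in *; set (v := sqrt (1 - y ^ 2)) in *.
assert (E : Rabs (u - v) * (u + v) = Rabs (x - y) * Rabs (x + y)).
{ rewrite <- (Rabs_pos_eq (u + v)) by lra.
  rewrite <- !Rabs_mult, <- Rabs_Ropp; f_equal; nra. }
assert (F : Rabs (x + y) <= 2) by (assert (A := Rabs_triang x y); lra).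
assert (P1 := Rabs_pos (u - v)); assert (P2 := Rabs_pos (x - y)).
assert (Rabs (u - v) <= Rabs (x - y) * / r); [|lra].
apply (Rmult_le_reg_r (2 * r)); [lra|].
replace (Rabs (x - y) * / r * (2 * r)) with (Rabs (x - y) * 2) by (field; lra).
nra.
Qed.

Definition theta (s : pm) (be : nat -> R) (m : nat) : C :=
  Cprod (fun j => zeta s (be j)) m.

Lemma Cmod_theta (s : pm) (be : nat -> R) (m : nat) :
  (forall m, Rabs (be m) <= 1) -> Cmod (theta s be m) = 1.
Proof.
intros H; induction m as [|m IH]; unfold theta in *; simpl; [apply Cmod_1|].
now rewrite Cmod_mult, IH, Cmod_zeta; [ring|].
Qed.

Lemma theta_mul_opp (s : pm) (be : nat -> R) (m : nat) :
  (forall m, Rabs (be m) <= 1) ->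
  (theta s be m * theta (opp_pm s) be m)%C = RtoC 1.
Proof.
intros H; induction m as [|m IH]; unfold theta in *; simpl; [ring|].
set (x := Cprod (fun j => zeta s (be j)) m) in *.
set (y := Cprod (fun j => zeta (opp_pm s) (be j)) m) in *.
replace (x * zeta s (be m) * (y * zeta (opp_pm s) (be m)))%C
  with ((x * y) * (zeta s (be m) * zeta (opp_pm s) (be m)))%C by ring.
rewrite IH, zeta_mul_opp by apply H; ring.
Qed.

(* Variation of parameters: [amp s be y] is the coefficient of [theta s be] when
   the pair [(y m, y (S m))] is expanded over the pairs
   [(theta s be m, theta s be (S m))], for both signs [s]. *)
Definition amp (s : pm) (be : nat -> R) (y : nat -> C) (m : nat) : C :=
  ((y (S m) - zeta (opp_pm s) (be m) * y m)
   / (theta s be m * (zeta s (be m) - zeta (opp_pm s) (be m))))%C.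

Definition amp_norm (be : nat -> R) (y : nat -> C) (m : nat) : R :=
  Cmod (amp Plus be y m) + Cmod (amp Minus be y m).

Lemma amp_normE (s : pm) (be : nat -> R) (y : nat -> C) (m : nat) :
  amp_norm be y m = Cmod (amp s be y m) + Cmod (amp (opp_pm s) be y m).
Proof. unfold amp_norm; destruct s; simpl; ring. Qed.

Lemma amp_norm_ge_0 (be : nat -> R) (y : nat -> C) (m : nat) :
  0 <= amp_norm be y m.
Proof.
unfold amp_norm; assert (A := Cmod_ge_0 (amp Plus be y m)).
assert (B := Cmod_ge_0 (amp Minus be y m)); lra.
Qed.

Lemma ex_series_bounded (u : nat -> R) :
  ex_series u -> (forall n, 0 <= u n) -> exists M, forall n, u n <= M.
Proof.
intros Hu u0; destruct (summable_tail u Hu) as [T [HT HL]].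
assert (T0 := tail_nonneg u T u0 HT HL).
exists (T O); intros n.
assert (H : T n <= T O).
{ induction n as [|n IH]; [lra|]; specialize (HT n); specialize (u0 n); lra. }
specialize (HT n); specialize (T0 (S n)); lra.
Qed.

(** * Estimates for the amplitudes when [be] is bounded away from one in modulus *)

Section Elliptic.

Variables (be : nat -> R) (q : R).
Hypothesis q1 : q < 1.
Hypothesis Hbe : forall m, Rabs (be m) <= q.

Lemma be_le_1 (m : nat) : Rabs (be m) <= 1.
Proof. specialize (Hbe m); lra. Qed.

Lemma sqrt_gap_pos : 0 < sqrt (1 - q ^ 2).
Proof.
assert (0 <= q) by (apply Rle_trans with (2 := Hbe O), Rabs_pos).
apply sqrt_lt_R0; nra.
Qed.

Lemma sqrt_gap_le (m : nat) : sqrt (1 - q ^ 2) <= sqrt (1 - be m ^ 2).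
Proof.
apply sqrt_le_1_alt; specialize (Hbe m); apply Rabs_le_between in Hbe; nra.
Qed.

Lemma theta_neq_0 (s : pm) (m : nat) : theta s be m <> RtoC 0.
Proof.
apply Cmod_gt_0; rewrite Cmod_theta by apply be_le_1; lra.
Qed.

Lemma zeta_sub_opp_neq_0 (s : pm) (m : nat) :
  (zeta s (be m) - zeta (opp_pm s) (be m))%C <> RtoC 0.
Proof.
apply Cmod_gt_0; rewrite Cmod_zeta_sub_opp.
assert (A := sqrt_gap_pos); assert (B := sqrt_gap_le m); lra.
Qed.

(** Together with the expansion of [y (S m)], this inverts a two by two system whose determinant is,
    up to sign, the nonzero difference of the two [zeta], because the two [theta] are inverse to
    each other. *)
Lemma amp_expand (s : pm) (y : nat -> C) (m : nat) :
  y m = (theta s be m * amp s be y m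
         + theta (opp_pm s) be m * amp (opp_pm s) be y m)%C.
Proof.
unfold amp; rewrite opp_pmK.
assert (H1 := theta_neq_0 s m); assert (H2 := theta_neq_0 (opp_pm s) m).
assert (H3 := zeta_sub_opp_neq_0 s m).
assert (H4 := zeta_sub_opp_neq_0 (opp_pm s) m); rewrite opp_pmK in H4.
field; repeat split; assumption.
Qed.

Lemma amp_expand_succ (s : pm) (y : nat -> C) (m : nat) :
  y (S m) = (theta s be (S m) * amp s be y m
             + theta (opp_pm s) be (S m) * amp (opp_pm s) be y m)%C.
Proof.
unfold amp; rewrite opp_pmK.
assert (H1 := theta_neq_0 s m); assert (H2 := theta_neq_0 (opp_pm s) m).
assert (H3 := zeta_sub_opp_neq_0 s m).
assert (H4 := zeta_sub_opp_neq_0 (opp_pm s) m); rewrite opp_pmK in H4.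
unfold theta in *; simpl; field; repeat split; assumption.
Qed.

Lemma Cmod_le_amp_norm (y : nat -> C) (m : nat) : Cmod (y m) <= amp_norm be y m.
Proof.
rewrite (amp_expand Plus y m) at 1; eapply Rle_trans; [apply Cmod_triangle|].
rewrite !Cmod_mult, !Cmod_theta by apply be_le_1; unfold amp_norm; simpl; lra.
Qed.

Lemma Cmod_succ_le_amp_norm (y : nat -> C) (m : nat) :
  Cmod (y (S m)) <= amp_norm be y m.
Proof.
rewrite (amp_expand_succ Plus y m) at 1; eapply Rle_trans; [apply Cmod_triangle|].
rewrite !Cmod_mult, !Cmod_theta by apply be_le_1; unfold amp_norm; simpl; lra.
Qed.

(** Converse to the two preceding bounds: two consecutive values control the amplitudes. It serves
    for initial data and for sequences with known asymptotics. *)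
Lemma Cmod_amp_le (s : pm) (y : nat -> C) (m : nat) :
  Cmod (amp s be y m) <= (Cmod (y (S m)) + Cmod (y m)) / (2 * sqrt (1 - q ^ 2)).
Proof.
unfold amp.
assert (H3 := zeta_sub_opp_neq_0 s m); assert (H1 := theta_neq_0 s m).
rewrite Cmod_div by now apply Cmult_neq_0.
rewrite Cmod_mult, Cmod_theta, Cmod_zeta_sub_opp by apply be_le_1.
rewrite Rmult_1_l.
assert (A := sqrt_gap_pos); assert (B := sqrt_gap_le m).
apply Rmult_le_compat; try apply Cmod_ge_0.
- apply Rlt_le, Rinv_0_lt_compat; lra.
- replace (y (S m)) with (y (S m) - 0)%C at 2 by ring.
  assert (E := Cmod_triangle_minus (y (S m)) 0 (zeta (opp_pm s) (be m) * y m)).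
  rewrite (Cmod_minus_sym 0) in E.
  replace (zeta (opp_pm s) (be m) * y m - 0)%C
    with (zeta (opp_pm s) (be m) * y m)%C in E by ring.
  rewrite Cmod_mult, Cmod_zeta in E by apply be_le_1; lra.
- apply Rinv_le_contravar; lra.
Qed.

Variables (ka al : nat -> R).

(** The rescaled Jacobi equation solved for its last term, with [1 + ka m] standing for [1 / k_n].
    The source [x] is present because Taylor coefficients in [z] obey the same equation, driven by
    the coefficient one order lower. *)
Definition perturbed_recurrence (z : C) (x y : nat -> C) : Prop :=
  forall m, y (S (S m)) =
    (RtoC (1 + ka m) * (2 * (RtoC (be (S m)) + z * RtoC (al m)) * y (S m) - y m
       + 2 * RtoC (al m) * x (S m)))%C.

Hypothesis al0 : forall m, 0 <= al m.

(** The numerator collects the variation of [zeta], the spectral term and the perturbation of the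
    leading coefficient; the summand 1 in [Cmod z + 1] pays for the source. The denominator is the
    lower bound for the modulus of the difference of the two [zeta]. *)
Definition step_bound (z : C) (m : nat) : R :=
  (Rabs (be (S m) - be m) * (1 + / sqrt (1 - q ^ 2)) + 2 * al m * (Cmod z + 1)
   + Rabs (ka m) * (3 + 2 * al m * (Cmod z + 1))) / (2 * sqrt (1 - q ^ 2)).

Lemma step_bound_ge_0 (z : C) (m : nat) : 0 <= step_bound z m.
Proof.
assert (A := sqrt_gap_pos); assert (Z0 := Cmod_ge_0 z); specialize (al0 m).
assert (B := Rabs_pos (be (S m) - be m)); assert (K := Rabs_pos (ka m)).
assert (I := Rinv_0_lt_compat _ A).
apply Rmult_le_pos; [|apply Rlt_le, Rinv_0_lt_compat; lra].
repeat apply Rplus_le_le_0_compat; repeat apply Rmult_le_pos;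
  try apply Rplus_le_le_0_compat; repeat apply Rmult_le_pos; lra.
Qed.

(** A summable [al] is bounded, which makes the products [Rabs (ka m) * al m] summable. *)
Lemma step_bound_summable (z : C) :
  ex_series (fun m => Rabs (be (S m) - be m)) -> ex_series al ->
  ex_series (fun m => Rabs (ka m)) -> ex_series (step_bound z).
Proof.
intros Hb Ha Hk.
destruct (ex_series_bounded al Ha al0) as [M HM].
assert (Z0 := Cmod_ge_0 z).
apply (ex_series_scal_r (/ (2 * sqrt (1 - q ^ 2)))).
apply (ex_series_plus (V := R_NormedModule)).
- apply (ex_series_plus (V := R_NormedModule)).
  + now apply ex_series_scal_r.
  + apply (ex_series_ext (fun m => al m * (2 * (Cmod z + 1)))).
    * intros m; match goal with |- ?u = ?v => change (@eq R u v) end; ring.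
    * now apply ex_series_scal_r.
- apply (ex_series_le (V := R_CompleteNormedModule) _
           (fun m => Rabs (ka m) * (3 + 2 * M * (Cmod z + 1)))).
  + intros m; change (norm ?x) with (Rabs x).
    assert (K := Rabs_pos (ka m)); specialize (al0 m); specialize (HM m).
    rewrite Rabs_mult, Rabs_Rabsolu; apply Rmult_le_compat_l; [exact K|].
    rewrite Rabs_pos_eq by nra; nra.
  + now apply ex_series_scal_r.
Qed.

(** With constant [be] and with [ka], [al] equal to zero the amplitudes would be conserved; the
    increment is therefore linear in the change of [zeta], in [al m] and in [ka m]. *)
Lemma amp_step (s : pm) (z : C) (x y : nat -> C) (m : nat) :
  perturbed_recurrence z x y ->
  Cmod (amp s be y (S m) - amp s be y m)
  <= step_bound z m * (amp_norm be y m + amp_norm be x m).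
Proof.
intros Hy; specialize (Hy m).
set (P := amp s be y m); set (Q := amp (opp_pm s) be y m).
set (th := theta s be (S m)); set (th' := theta (opp_pm s) be (S m)).
set (D := (zeta s (be (S m)) - zeta (opp_pm s) (be (S m)))%C).
set (w := (2 * (RtoC (be (S m)) + z * RtoC (al m)) * y (S m) - y m
       + 2 * RtoC (al m) * x (S m))%C).
assert (E : (amp s be y (S m) - P =
  ((zeta (opp_pm s) (be (S m)) - zeta (opp_pm s) (be m)) * (th * P)
   + (zeta s (be (S m)) - zeta s (be m)) * (th' * Q)
   + 2 * RtoC (al m) * (z * y (S m) + x (S m)) + RtoC (ka m) * w) / (th * D))%C).
{ assert (Y1 : y (S m) = (th * P + th' * Q)%C) by apply amp_expand_succ.
  (* [y m] is expressed through [theta] at [S m]: since the two [zeta] are inverse to each other,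
     going back one step multiplies by the opposite one. *)
  assert (Y0 : y m = (zeta (opp_pm s) (be m) * th * P + zeta s (be m) * th' * Q)%C).
  { rewrite (amp_expand s y m); fold P Q; unfold th, th', theta; simpl.
    fold (theta s be m) (theta (opp_pm s) be m).
    replace (zeta (opp_pm s) (be m) * (theta s be m * zeta s (be m)) * P)%C
      with ((zeta s (be m) * zeta (opp_pm s) (be m)) * theta s be m * P)%C by ring.
    replace (zeta s (be m) * (theta (opp_pm s) be m * zeta (opp_pm s) (be m)) * Q)%C
      with ((zeta s (be m) * zeta (opp_pm s) (be m)) * theta (opp_pm s) be m * Q)%C
      by ring.
    rewrite zeta_mul_opp by apply be_le_1; ring. }
  assert (B := zeta_add_opp s (be (S m))).
  assert (W : w = ((zeta s (be (S m)) + zeta (opp_pm s) (be (S m))) * y (S m) - y m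
     + 2 * RtoC (al m) * (z * y (S m) + x (S m)))%C).
  { rewrite B; unfold w; ring. }
  assert (Y2 : y (S (S m)) = (w + RtoC (ka m) * w)%C).
  { rewrite Hy; fold w; rewrite RtoC_plus; ring. }
  unfold amp at 1; rewrite Y2; fold th D.
  (* Only the [w] without the factor [ka m] is expanded; the other stays a symbol occurring on both
     sides. *)
  clearbody w; rewrite W at 1; rewrite Y1, Y0.
  assert (th <> RtoC 0) by apply theta_neq_0.
  assert (D <> RtoC 0) by apply zeta_sub_opp_neq_0.
  unfold D in *; field; split; assumption. }
rewrite E.
assert (Hth : Cmod th = 1) by (apply Cmod_theta, be_le_1).
assert (Hth' : Cmod th' = 1) by (apply Cmod_theta, be_le_1).
assert (HD : 2 * sqrt (1 - q ^ 2) <= Cmod D).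
{ unfold D; rewrite Cmod_zeta_sub_opp; assert (B := sqrt_gap_le (S m)); lra. }
assert (r0 := sqrt_gap_pos).
rewrite Cmod_div
  by (apply Cmult_neq_0; [apply theta_neq_0|apply zeta_sub_opp_neq_0]).
rewrite (Cmod_mult th), Hth, Rmult_1_l.
unfold step_bound, Rdiv.
rewrite (Rmult_comm (_ + _ + _)), (Rmult_assoc (/ _)), (Rmult_comm (/ _)).
apply Rmult_le_compat; try apply Cmod_ge_0;
  [apply Rlt_le, Rinv_0_lt_compat; lra| |apply Rinv_le_contravar; lra].
set (Ny := amp_norm be y m); set (Nx := amp_norm be x m).
assert (HN : Ny = Cmod P + Cmod Q) by apply amp_normE.
assert (Hy1 : Cmod (y (S m)) <= Ny) by apply Cmod_succ_le_amp_norm.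
assert (Hy0 : Cmod (y m) <= Ny) by apply Cmod_le_amp_norm.
assert (Hx1 : Cmod (x (S m)) <= Nx) by apply Cmod_succ_le_amp_norm.
assert (Nx0 : 0 <= Nx) by apply amp_norm_ge_0.
assert (Ny0 : 0 <= Ny) by apply amp_norm_ge_0.
assert (Z1 := Cmod_zeta_sub s q (be (S m)) (be m) q1 (Hbe _) (Hbe _)).
assert (Z2 := Cmod_zeta_sub (opp_pm s) q (be (S m)) (be m) q1 (Hbe _) (Hbe _)).
set (dz := Rabs (be (S m) - be m) * (1 + / sqrt (1 - q ^ 2))) in *.
assert (z0 := Cmod_ge_0 z); specialize (al0 m).
assert (T1 : Cmod (z * y (S m) + x (S m)) <= (Cmod z + 1) * (Ny + Nx)).
{ eapply Rle_trans; [apply Cmod_triangle|]; rewrite Cmod_mult; nra. }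
assert (A2 : Cmod (2 * RtoC (al m)) = 2 * al m).
{ rewrite <- RtoC_mult, Cmod_R, Rabs_pos_eq; lra. }
(* The constant 3 is the bound for [2 be (S m) y (S m) - y m] in units of [Ny]. *)
assert (T2 : Cmod w <= (3 + 2 * al m * (Cmod z + 1)) * (Ny + Nx)).
{ replace w with (2 * RtoC (be (S m)) * y (S m) + (-(1)) * y m
    + 2 * RtoC (al m) * (z * y (S m) + x (S m)))%C by (unfold w; ring).
  eapply Rle_trans; [apply Cmod_triangle|].
  rewrite (Cmod_mult (2 * RtoC (al m))), A2.
  assert (U : Cmod (2 * be (S m) * y (S m) + - (1) * y m) <= 3 * Ny).
  { eapply Rle_trans; [apply Cmod_triangle|].
    rewrite !Cmod_mult, Cmod_opp, !Cmod_R, Rabs_R1, (Rabs_pos_eq 2) by lra.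
    assert (b1 := be_le_1 (S m)); assert (b0 := Rabs_pos (be (S m))).
    assert (Rabs (be (S m)) * Cmod (y (S m)) <= 1 * Ny); [|lra].
    apply Rmult_le_compat; auto using Cmod_ge_0. }
  assert (2 * al m * Cmod (z * y (S m) + x (S m))
          <= 2 * al m * ((Cmod z + 1) * (Ny + Nx)))
    by (apply Rmult_le_compat_l; lra).
  nra. }
assert (T3 : Cmod (2 * RtoC (al m) * (z * y (S m) + x (S m)))
  <= 2 * al m * (Cmod z + 1) * (Ny + Nx)).
{ rewrite Cmod_mult, A2, (Rmult_assoc (2 * al m)); apply Rmult_le_compat_l; lra. }
assert (T4 : Cmod (RtoC (ka m) * w)
  <= Rabs (ka m) * (3 + 2 * al m * (Cmod z + 1)) * (Ny + Nx)).
{ rewrite Cmod_mult, Cmod_R, Rmult_assoc; apply Rmult_le_compat_l;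
    auto using Rabs_pos. }
assert (T5 : Cmod ((zeta (opp_pm s) (be (S m)) - zeta (opp_pm s) (be m)) * (th * P)
  + (zeta s (be (S m)) - zeta s (be m)) * (th' * Q)) <= dz * (Ny + Nx)).
{ eapply Rle_trans; [apply Cmod_triangle|].
  rewrite !Cmod_mult, Hth, Hth'.
  assert (p0 := Cmod_ge_0 P); assert (q0 := Cmod_ge_0 Q).
  assert (A := Cmod_ge_0 (zeta s (be (S m)) - zeta s (be m))).
  assert (dz * Nx >= 0) by nra. rewrite HN at 1; nra. }
eapply Rle_trans; [apply Cmod_triangle|].
eapply Rle_trans; [apply Rplus_le_compat_r, Cmod_triangle|].
lra.
Qed.

Definition previous (y : nat -> nat -> C) (j : nat) : nat -> C :=
  match j with O => fun _ => RtoC 0 | S i => y i end.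

Lemma amp_norm_previous_sum (y : nat -> nat -> C) (m J : nat) :
  sum_n (fun j => amp_norm be (previous y j) m) J
  <= sum_n (fun j => amp_norm be (y j) m) J.
Proof.
assert (Z : amp_norm be (fun _ => RtoC 0) m = 0).
{ unfold amp_norm, amp, Cdiv.
  replace (RtoC 0 - _)%C with (RtoC 0) by ring.
  replace (RtoC 0 - _)%C with (RtoC 0) by ring.
  rewrite !Cmod_mult, Cmod_0; ring. }
assert (H : forall J, sum_n (fun j => amp_norm be (previous y j) m) (S J)
  = sum_n (fun j => amp_norm be (y j) m) J).
{ induction J0 as [|i IH].
  - rewrite sum_Sn, !sum_O; simpl; rewrite Z; apply Rplus_0_l.
  - rewrite sum_Sn, IH, sum_Sn; reflexivity. }
destruct J as [|J].
- rewrite !sum_O; simpl; rewrite Z; apply amp_norm_ge_0.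
- rewrite H, sum_Sn; unfold plus; simpl.
  assert (A := amp_norm_ge_0 be (y (S J)) m); lra.
Qed.

(** The Gronwall estimate is applied to the amplitude norms summed over [j <= J]. Sources are the
    same family shifted by one, so their sum is bounded by the same quantity and the system of
    estimates closes, uniformly in [J]. *)
Lemma amp_summable_steps (z : C) (y : nat -> nat -> C) (B : R) :
  ex_series (step_bound z) ->
  (forall j, perturbed_recurrence z (previous y j) (y j)) ->
  (forall J, sum_n (fun j => amp_norm be (y j) O) J <= B) ->
  exists e : nat -> R, ex_series e /\
    forall s m J,
      sum_n (fun j => Cmod (amp s be (y j) (S m) - amp s be (y j) m)) J <= e m.
Proof.
intros Hd Hy HB.
(* One factor 2 absorbs the source, the other counts the two signs. *)
set (d := fun m => 4 * step_bound z m).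
assert (Hd' : ex_series d) by exact (ex_series_scal_l 4 _ Hd).
set (S_ := fun J m => sum_n (fun j => amp_norm be (y j) m) J).
assert (Step : forall s m J,
  sum_n (fun j => Cmod (amp s be (y j) (S m) - amp s be (y j) m)) J
  <= 2 * step_bound z m * S_ J m).
{ intros s m J.
  eapply Rle_trans;
    [apply sum_n_le; intros j; apply (amp_step s z _ _ m (Hy j))|].
  rewrite sum_n_scal_R, sum_n_plus_R.
  assert (A := amp_norm_previous_sum y m J); fold (S_ J m) in *.
  assert (D0 := step_bound_ge_0 z m); nra. }
assert (G : forall J m, S_ J m <= exp (Series d) * S_ J O).
{ intros J; apply gronwall; auto.
  - intros m; unfold d; assert (A := step_bound_ge_0 z m); lra.
  - intros m; apply sum_n_nonneg; intros j; apply amp_norm_ge_0.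
  - intros m.
    assert (A1 := Step Plus m J); assert (A2 := Step Minus m J).
    assert (A : S_ J (S m) <= sum_n (fun j => amp_norm be (y j) m
       + (Cmod (amp Plus be (y j) (S m) - amp Plus be (y j) m)
        + Cmod (amp Minus be (y j) (S m) - amp Minus be (y j) m))) J).
    { apply sum_n_le; intros j; unfold amp_norm.
      assert (U : forall u v : C, Cmod u <= Cmod v + Cmod (u - v)).
      { intros u v; replace u with (v + (u - v))%C at 1 by ring.
        apply Cmod_triangle. }
      assert (U1 := U (amp Plus be (y j) (S m)) (amp Plus be (y j) m)).
      assert (U2 := U (amp Minus be (y j) (S m)) (amp Minus be (y j) m)); lra. }
    rewrite !sum_n_plus_R in A; fold (S_ J m) in A; unfold d; lra. }
exists (fun m => step_bound z m * (2 * (exp (Series d) * B))); split.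
- now apply ex_series_scal_r.
- intros s m J; apply Rle_trans with (1 := Step s m J).
  assert (D0 := step_bound_ge_0 z m).
  assert (S_ J m <= exp (Series d) * B).
  { eapply Rle_trans; [apply G|].
    apply Rmult_le_compat_l; [apply Rlt_le, exp_pos|apply HB]. }
  nra.
Qed.

End Elliptic.

(** * Positive sequences with ratios summably close to one *)

Lemma inv_minus_1_summable (k : nat -> R) :
  (forall n, 0 < k n) -> ex_series (fun n => Rabs (k n - 1)) ->
  ex_series (fun n => Rabs (/ k n - 1)).
Proof.
intros k0 Hk.
assert (L := ex_series_lim_0 _ Hk).
apply is_lim_seq_spec in L.
assert (h2 : 0 < / 2) by lra.
destruct (L (mkposreal _ h2)) as [N HN]; simpl in HN.
apply (ex_series_incr_n (V := R_NormedModule) _ N).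
apply (ex_series_incr_n (V := R_NormedModule) _ N) in Hk.
apply (ex_series_le (V := R_CompleteNormedModule) _
         (* From index [N] on [k >= 1/2], so [1 / k - 1 = - (k - 1) / k] is at most [2 Rabs (k - 1)]
            in modulus. *)
         (fun n => 2 * Rabs (k (N + n)%nat - 1))).
- intros n; change (norm ?x) with (Rabs x); rewrite Rabs_Rabsolu.
  specialize (HN (N + n)%nat (Nat.le_add_r _ _)); specialize (k0 (N + n)%nat).
  rewrite Rminus_0_r, Rabs_Rabsolu in HN.
  set (x := k (N + n)%nat) in *.
  replace (/ x - 1) with ((- (x - 1)) * / x) by (field; lra).
  rewrite Rabs_mult, Rabs_Ropp, Rmult_comm.
  apply Rmult_le_compat_r; [apply Rabs_pos|].
  assert (/ 2 <= x) by (apply Rabs_lt_between in HN; lra).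
  rewrite Rabs_pos_eq by (apply Rlt_le, Rinv_0_lt_compat; lra).
  replace 2 with (/ / 2) by field; apply Rinv_le_contravar; lra.
- exact (ex_series_scal_l 2 _ Hk).
Qed.

Lemma gronwall_ratio (v r : nat -> R) :
  (forall n, 0 < v n) -> (forall n, v (S n) = r n * v n) ->
  ex_series (fun n => Rabs (r n - 1)) ->
  exists K, forall n, v n <= K.
Proof.
intros v0 Hv Hr.
exists (exp (Series (fun n => Rabs (r n - 1))) * v O); intros n.
apply (gronwall v (fun n => Rabs (r n - 1)) Hr).
- intros; apply Rabs_pos.
- intros m; apply Rlt_le, v0.
- intros m; rewrite Hv; apply Rmult_le_compat_r; [apply Rlt_le, v0|].
  assert (A := Rle_abs (r m - 1)); lra.
Qed.

(** Gronwall bounds both [v] and [1 / v]. The second bound makes the increments of [1 / v] summable,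
    and the first keeps the limit of [1 / v] away from zero. *)
Lemma positive_limit_of_ratios (v : nat -> R) :
  (forall n, 0 < v n) -> ex_series (fun n => Rabs (v n / v (S n) - 1)) ->
  exists l : R, 0 < l /\ is_lim_seq v l.
Proof.
intros v0 Hr.
assert (r0 : forall n, 0 < v n / v (S n)) by (intros; now apply Rdiv_lt_0_compat).
destruct (gronwall_ratio v (fun n => / (v n / v (S n))) v0) as [K HK].
{ intros n; assert (A := v0 n); assert (B := v0 (S n)); field; lra. }
{ now apply inv_minus_1_summable. }
assert (g0 : forall n, 0 < / v n) by (intros; now apply Rinv_0_lt_compat).
destruct (gronwall_ratio (fun n => / v n) (fun n => v n / v (S n)) g0) as [K' HK'].
{ intros n; assert (A := v0 n); assert (B := v0 (S n)); field; lra. }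
{ exact Hr. }
destruct (is_lim_seq_of_summable_steps (fun n => / v n)
  (fun n => Rabs (v n / v (S n) - 1) * K')) as [l Hl].
{ now apply ex_series_scal_r. }
{ intros n; assert (A := v0 n); assert (B := v0 (S n)).
  replace (/ v (S n) - / v n) with ((v n / v (S n) - 1) * / v n) by (field; lra).
  rewrite Rabs_mult, (Rabs_pos_eq (/ v n)) by (apply Rlt_le, g0).
  apply Rmult_le_compat_l; [apply Rabs_pos|apply HK']. }
assert (K0 : 0 < K) by (apply Rlt_le_trans with (1 := v0 O), HK).
assert (Kl : / K <= l).
{ apply (is_lim_seq_le (fun _ => / K) (fun n => / v n) (/ K) l).
  - intros n; apply Rinv_le_contravar; [apply v0|apply HK].
  - apply is_lim_seq_const.
  - exact Hl. }
assert (l0 : 0 < l) by (apply Rlt_le_trans with (2 := Kl), Rinv_0_lt_compat, K0).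
exists (/ l); split; [now apply Rinv_0_lt_compat|].
apply (is_lim_seq_ext (fun n => / / v n)); [intros n; now rewrite Rinv_inv|].
apply (is_lim_seq_inv _ l Hl); intros E; injection E; lra.
Qed.

(** * Amplitudes, Casoratians and asymptotic form *)

Lemma amp_linear (s : pm) (be : nat -> R) (c d : C) (x y : nat -> C) (m : nat) :
  amp s be (fun i => c * x i + d * y i)%C m
  = (c * amp s be x m + d * amp s be y m)%C.
Proof. unfold amp, Cdiv; ring. Qed.

Lemma amp_ext (s : pm) (be : nat -> R) (x y : nat -> C) (m : nat) :
  x m = y m -> x (S m) = y (S m) -> amp s be x m = amp s be y m.
Proof. intros H0 H1; unfold amp; now rewrite H0, H1. Qed.

Section EllipticAsymptotics.

Variables (be : nat -> R) (q : R).
Hypothesis q1 : q < 1.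
Hypothesis Hbe : forall m, Rabs (be m) <= q.

Lemma amp_theta (s : pm) (m : nat) : amp s be (theta s be) m = RtoC 1.
Proof.
assert (H1 := theta_neq_0 be q q1 Hbe s m).
assert (H2 := zeta_sub_opp_neq_0 be q q1 Hbe s m).
unfold amp, theta in *; simpl; field; split; assumption.
Qed.

Lemma amp_opp_theta (s : pm) (m : nat) : amp (opp_pm s) be (theta s be) m = RtoC 0.
Proof.
unfold amp, theta, Cdiv; simpl; rewrite opp_pmK; ring.
Qed.

(** The diagonal products cancel; in the mixed ones the two [theta] multiply to one, leaving the
    difference of the two [zeta]. *)
Lemma casoratian_amp (x y : nat -> C) (m : nat) :
  (x m * y (S m) - x (S m) * y m)%C
  = (2 * Ci * RtoC (sqrt (1 - be m ^ 2))
     * (amp Plus be x m * amp Minus be y m - amp Minus be x m * amp Plus be y m))%C.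
Proof.
rewrite (amp_expand be q q1 Hbe Plus x m), (amp_expand be q q1 Hbe Plus y m).
rewrite (amp_expand_succ be q q1 Hbe Plus x m).
rewrite (amp_expand_succ be q q1 Hbe Plus y m); simpl opp_pm.
set (P := amp Plus be x m); set (Q := amp Minus be x m).
set (P' := amp Plus be y m); set (Q' := amp Minus be y m).
assert (E := theta_mul_opp Plus be m (be_le_1 be q q1 Hbe)); simpl in E.
assert (F := zeta_sub_opp Plus (be m)); simpl in F; rewrite Rmult_1_l in F.
unfold theta in *; simpl.
set (t := Cprod (fun j => zeta Plus (be j)) m) in *.
set (t' := Cprod (fun j => zeta Minus (be j)) m) in *.
transitivity ((t * t') * (- (zeta Plus (be m) - zeta Minus (be m)))
              * (P * Q' - Q * P'))%C; [ring|].
rewrite E, F; ring.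
Qed.

(** [theta s be] has the exact amplitudes 1 and 0, and [y - theta s be] tends to zero, hence so do
    its amplitudes. *)
Lemma asymptotic_amps (s : pm) (y eps : nat -> C) :
  Clim eps 0 -> (forall m, y (S m) = theta s be (S m) * (1 + eps (S m)))%C ->
  Clim (amp s be y) 1 /\ Clim (amp (opp_pm s) be y) 0.
Proof.
intros He Hy.
assert (H : forall s', Clim (fun m => amp s' be (fun i => y i - theta s be i)%C m) 0).
(* The hypothesis covers indices from 1 on and an amplitude at [m] involves [y m], so the estimate
   starts at [m = 1]. *)
{ intros s'; apply (Clim_incr_n _ 1 0).
  apply (Clim_le _ _ (fun m => (Cmod (eps (S (m + 1))) + Cmod (eps (m + 1)%nat))
                              / (2 * sqrt (1 - q ^ 2)))).
  - intros m; rewrite Nat.add_1_r.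
    match goal with |- Cmod (Cminus ?u _) <= _ => replace (u - RtoC 0)%C with u by ring end.
    eapply Rle_trans; [apply (Cmod_amp_le be q q1 Hbe)|].
    assert (A := sqrt_gap_pos be q q1 Hbe).
    apply Rmult_le_compat_r; [apply Rlt_le, Rinv_0_lt_compat; lra|].
    assert (U : forall i, Cmod (y (S i) - theta s be (S i)) = Cmod (eps (S i))).
    { intros i; rewrite Hy.
      replace (theta s be (S i) * (1 + eps (S i)) - theta s be (S i))%C
        with (theta s be (S i) * eps (S i))%C by ring.
      rewrite Cmod_mult, Cmod_theta by apply (be_le_1 be q q1 Hbe); ring. }
    rewrite !U; apply Rle_refl.
  - replace (Finite 0) with (Finite ((0 + 0) * / (2 * sqrt (1 - q ^ 2))))
      by (f_equal; ring).
    apply is_lim_seq_mult'; [|apply is_lim_seq_const].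
    apply Clim_Cmod in He; rewrite Cmod_0 in He.
    apply is_lim_seq_plus'.
    + apply (is_lim_seq_ext (fun m => Cmod (eps (m + 2)%nat))).
      * intros m; do 2 f_equal; lia.
      * now apply (is_lim_seq_incr_n (fun m => Cmod (eps m)) 2 0).
    + now apply (is_lim_seq_incr_n (fun m => Cmod (eps m)) 1 0). }
split.
- assert (K := Clim_plus _ _ _ _ (H s) (Clim_const 1)).
  replace (0 + 1)%C with (RtoC 1) in K by ring; revert K; apply Clim_ext.
  intros m; rewrite <- (amp_theta s m); unfold amp, Cdiv; ring.
- assert (K := Clim_plus _ _ _ _ (H (opp_pm s)) (Clim_const 0)).
  replace (0 + 0)%C with (RtoC 0) in K by ring; revert K; apply Clim_ext.
  intros m; rewrite <- (amp_opp_theta s m); unfold amp, Cdiv; ring.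
Qed.

Lemma amps_asymptotic (s : pm) (y : nat -> C) :
  Clim (amp s be y) 1 -> Clim (amp (opp_pm s) be y) 0 ->
  exists eps : nat -> C, Clim eps 0 /\ forall m, y m = (theta s be m * (1 + eps m))%C.
Proof.
intros H1 H0.
(* Dividing the expansion of [y m] by [theta s be m] amounts to multiplying by the opposite [theta];
   its square, of modulus one, thus multiplies the vanishing amplitude. *)
exists (fun m => (amp s be y m - 1) + (theta (opp_pm s) be m * theta (opp_pm s) be m)
                  * amp (opp_pm s) be y m)%C; split.
- replace (RtoC 0) with ((1 - 1) + 0)%C by ring.
  apply Clim_plus; [apply Clim_minus; auto using Clim_const|].
  apply (Clim_bounded_mult_0 _ _ 1); [|exact H0].
  intros m; rewrite Cmod_mult, Cmod_theta by apply (be_le_1 be q q1 Hbe); lra.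
- intros m; rewrite (amp_expand be q q1 Hbe s y m) at 1.
  assert (E := theta_mul_opp s be m (be_le_1 be q q1 Hbe)).
  set (t := theta s be m) in *; set (t' := theta (opp_pm s) be m) in *.
  set (P := amp s be y m); set (Q := amp (opp_pm s) be y m).
  transitivity (t * P + (t * t') * (t' * Q))%C; [rewrite E; ring|ring].
Qed.

End EllipticAsymptotics.

(** * The Jacobi equation *)

Lemma Z_ind_from_m1 (P : Z -> Prop) :
  P (-1)%Z -> P 0%Z ->
  (forall n, (0 <= n)%Z -> P (n - 1)%Z -> P n -> P (n + 1)%Z) ->
  forall n, (-1 <= n)%Z -> P n.
Proof.
intros Hm1 H0 HS.
assert (H : forall k : nat, P (Z.of_nat k - 1)%Z /\ P (Z.of_nat k)).
{ induction k as [|k [IH1 IH2]]; [now split|].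
  assert (G := HS (Z.of_nat k) ltac:(lia) IH1 IH2).
  replace (Z.of_nat (S k)) with (Z.of_nat k + 1)%Z by lia.
  replace (Z.of_nat k + 1 - 1)%Z with (Z.of_nat k) by lia; now split. }
intros n Hn; replace n with (Z.of_nat (Z.to_nat (n + 1)) - 1)%Z by lia; apply H.
Qed.

(** Stage [k] holds the values at indices [k - 1] and [k], so the pair of initial values sits at -1
    and 0. The value type is arbitrary in order to treat numbers and sequences of Taylor
    coefficients alike. *)
Fixpoint unroll_pair {V : Type} (step : Z -> V -> V -> V) (v0 v1 : V) (k : nat)
  : V * V :=
  match k with
  | O => (v0, v1)
  | S i => let p := unroll_pair step v0 v1 i in
           (snd p, step (Z.of_nat i) (fst p) (snd p))
  end.

Definition unroll {V : Type} (step : Z -> V -> V -> V) (v0 v1 : V) (n : Z) : V :=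
  fst (unroll_pair step v0 v1 (Z.to_nat (n + 1))).

Lemma unroll_succ {V : Type} (step : Z -> V -> V -> V) (v0 v1 : V) (n : Z) :
  (0 <= n)%Z ->
  unroll step v0 v1 (n + 1)
  = step n (unroll step v0 v1 (n - 1)) (unroll step v0 v1 n).
Proof.
intros Hn; unfold unroll.
replace (Z.to_nat (n + 1 + 1)) with (S (S (Z.to_nat n))) by lia.
replace (Z.to_nat (n + 1)) with (S (Z.to_nat n)) by lia.
replace (Z.to_nat (n - 1 + 1)) with (Z.to_nat n) by lia.
cbn -[Z.of_nat]; now rewrite Z2Nat.id.
Qed.

Definition jacobi_step (a b : Z -> R) (z : C) (n : Z) (u v : C) : C :=
  (((z - RtoC (b n)) * v - RtoC (a (n - 1)%Z) * u) / RtoC (a n))%C.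

Definition jacobi_unroll (a b : Z -> R) (z c0 c1 : C) : Z -> C :=
  unroll (jacobi_step a b z) c0 c1.

(** Multiplication by the expansion variable, on coefficients. *)
Definition shift_coeffs (v : nat -> C) (j : nat) : C :=
  match j with O => RtoC 0 | S i => v i end.

Definition const_coeffs (c : C) (j : nat) : C :=
  match j with O => c | S _ => RtoC 0 end.

(* Taylor coefficients at [z0] of the polynomial [z => jacobi_unroll a b z c0 c1 n]. *)
Definition jacobi_coeffs (a b : Z -> R) (z0 c0 c1 : C) : Z -> nat -> C :=
  unroll (fun n u v j =>
            ((z0 - RtoC (b n)) / RtoC (a n) * v j + / RtoC (a n) * shift_coeffs v j
             - RtoC (a (n - 1)%Z) / RtoC (a n) * u j)%C)
         (const_coeffs c0) (const_coeffs c1).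

Definition jacobi_with_source (a b : Z -> R) (z : C) (w u : Z -> C) : Prop :=
  forall n : Z, (0 <= n)%Z ->
    (RtoC (a (n - 1)%Z) * u (n - 1)%Z + RtoC (b n) * u n + RtoC (a n) * u (n + 1)%Z
     = z * u n + w n)%C.

(** * Operations on power series and analytic functions *)

Lemma is_pseries_linear (c d t lx ly : C) (x y : nat -> C) :
  @is_pseries C_AbsRing C_NormedModule x t lx ->
  @is_pseries C_AbsRing C_NormedModule y t ly ->
  @is_pseries C_AbsRing C_NormedModule (fun j => c * x j + d * y j)%C t
    (c * lx + d * ly)%C.
Proof.
intros Hx Hy.
apply (is_pseries_plus (V := C_NormedModule) (PS_scal c x) (PS_scal d y)).
- apply (is_pseries_scal (V := C_NormedModule) c x); [apply Cmult_comm|exact Hx].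
- apply (is_pseries_scal (V := C_NormedModule) d y); [apply Cmult_comm|exact Hy].
Qed.

Lemma is_pseries_shift (t l : C) (x : nat -> C) :
  @is_pseries C_AbsRing C_NormedModule x t l ->
  @is_pseries C_AbsRing C_NormedModule (shift_coeffs x) t (t * l)%C.
Proof. exact (is_pseries_incr_1 (V := C_NormedModule) x t l). Qed.

Lemma is_pseries_const (c t : C) :
  @is_pseries C_AbsRing C_NormedModule (const_coeffs c) t c.
Proof.
apply is_pseries_C_iff, (Clim_ext (fun _ => c)); [|apply Clim_const].
induction n as [|n IH].
- unfold pseries_partial; rewrite sum_O; simpl.
  change (c = 1 * c)%C; ring.
- rewrite pseries_partial_S, <- IH; simpl; ring.
Qed.

Lemma analytic_linear (c d : C) (f g : C -> C) :
  analytic f -> analytic g -> analytic (fun z => c * f z + d * g z)%C.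
Proof.
intros Hf Hg z0.
destruct (Hf z0) as [r1 [x Hx]], (Hg z0) as [r2 [y Hy]].
exists (mkposreal _ (Rmin_stable_in_posreal r1 r2)).
exists (fun j => c * x j + d * y j)%C; simpl; intros z Hz.
apply is_pseries_linear; [apply Hx|apply Hy];
  apply Rlt_le_trans with (1 := Hz); [apply Rmin_l|apply Rmin_r].
Qed.

(** Write [z = z0 + (z - z0)]; the second summand shifts the coefficients. *)
Lemma analytic_mult_id (f : C -> C) : analytic f -> analytic (fun z => z * f z)%C.
Proof.
intros Hf z0; destruct (Hf z0) as [r [x Hx]].
exists r, (fun j => z0 * x j + 1 * shift_coeffs x j)%C; intros z Hz.
replace (z * f z)%C with (z0 * f z + 1 * ((z - z0) * f z))%C by ring.
apply is_pseries_linear; [|apply is_pseries_shift]; now apply Hx.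
Qed.

Lemma analytic_ext (f g : C -> C) :
  (forall z, f z = g z) -> analytic f -> analytic g.
Proof.
intros E Hf z0; destruct (Hf z0) as [r [x Hx]].
exists r, x; intros z Hz; rewrite <- E; now apply Hx.
Qed.

Lemma RtoC_neq_0 (x : R) : x <> 0 -> RtoC x <> RtoC 0.
Proof. intros H E; apply H; now injection E. Qed.

(** * Solutions polynomial in the spectral parameter, and Wronskians *)

Section Jacobi.

Variables (a b : Z -> R).
Hypothesis a_pos : forall n : Z, (-1 <= n)%Z -> 0 < a n.

Lemma RtoC_a_neq_0 (n : Z) : (-1 <= n)%Z -> RtoC (a n) <> RtoC 0.
Proof. intros Hn; apply RtoC_neq_0; specialize (a_pos n Hn); lra. Qed.

Lemma jacobi_unroll_solution (z c0 c1 : C) :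
  jacobi_solution a b z (jacobi_unroll a b z c0 c1).
Proof.
intros n Hn; unfold jacobi_unroll; rewrite unroll_succ by exact Hn.
unfold jacobi_step; field; apply RtoC_a_neq_0; lia.
Qed.

Lemma jacobi_coeffs_succ (z0 c0 c1 : C) (n : Z) (j : nat) :
  (0 <= n)%Z ->
  jacobi_coeffs a b z0 c0 c1 (n + 1) j
  = ((z0 - RtoC (b n)) / RtoC (a n) * jacobi_coeffs a b z0 c0 c1 n j
     + / RtoC (a n) * shift_coeffs (jacobi_coeffs a b z0 c0 c1 n) j
     - RtoC (a (n - 1)%Z) / RtoC (a n) * jacobi_coeffs a b z0 c0 c1 (n - 1) j)%C.
Proof. intros Hn; unfold jacobi_coeffs; now rewrite unroll_succ. Qed.

(** Splitting [z u] into [z0 u + (z - z0) u] and comparing coefficients of order [j] yields the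
    coefficient of order [j - 1] as source. *)
Lemma jacobi_coeffs_source (z0 c0 c1 : C) (j : nat) :
  jacobi_with_source a b z0
    (fun n => shift_coeffs (jacobi_coeffs a b z0 c0 c1 n) j)
    (fun n => jacobi_coeffs a b z0 c0 c1 n j).
Proof.
intros n Hn; rewrite jacobi_coeffs_succ by exact Hn.
field; apply RtoC_a_neq_0; lia.
Qed.

Lemma jacobi_coeffs_pseries (z0 c0 c1 t : C) (n : Z) :
  (-1 <= n)%Z ->
  @is_pseries C_AbsRing C_NormedModule (jacobi_coeffs a b z0 c0 c1 n) t
    (jacobi_unroll a b (z0 + t) c0 c1 n).
Proof.
revert n; apply Z_ind_from_m1; [apply is_pseries_const|apply is_pseries_const|].
intros n Hn H1 H2.
apply (is_pseries_ext (V := C_NormedModule) (fun j =>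
   1 * ((z0 - RtoC (b n)) / RtoC (a n) * jacobi_coeffs a b z0 c0 c1 n j
     + / RtoC (a n) * shift_coeffs (jacobi_coeffs a b z0 c0 c1 n) j)
     + - (RtoC (a (n - 1)%Z) / RtoC (a n)) * jacobi_coeffs a b z0 c0 c1 (n - 1) j)%C).
{ intros j; rewrite jacobi_coeffs_succ by exact Hn; cbv beta.
  match goal with |- ?u = ?v => change (@eq C u v) end; ring. }
replace (jacobi_unroll a b (z0 + t) c0 c1 (n + 1)) with
  (1 * ((z0 - RtoC (b n)) / RtoC (a n) * jacobi_unroll a b (z0 + t) c0 c1 n
     + / RtoC (a n) * (t * jacobi_unroll a b (z0 + t) c0 c1 n))
   + - (RtoC (a (n - 1)%Z) / RtoC (a n)) * jacobi_unroll a b (z0 + t) c0 c1 (n - 1))%C.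
{ apply is_pseries_linear; [apply is_pseries_linear|]; auto using is_pseries_shift. }
unfold jacobi_unroll at 4; rewrite unroll_succ by exact Hn.
fold (jacobi_unroll a b (z0 + t) c0 c1).
unfold jacobi_step; field; apply RtoC_a_neq_0; lia.
Qed.

Lemma jacobi_coeffs_0 (z0 c0 c1 : C) (n : Z) :
  (-1 <= n)%Z ->
  jacobi_coeffs a b z0 c0 c1 n O = jacobi_unroll a b z0 c0 c1 n.
Proof.
revert n; apply Z_ind_from_m1; [reflexivity|reflexivity|].
intros n Hn H1 H2; rewrite jacobi_coeffs_succ, H1, H2 by exact Hn.
unfold jacobi_unroll; rewrite unroll_succ by exact Hn.
unfold jacobi_step; simpl; field; apply RtoC_a_neq_0; lia.
Qed.

Lemma shift_coeffs_sum (v : nat -> C) (J : nat) :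
  sum_n (fun j => Cmod (shift_coeffs v j)) J <= sum_n (fun j => Cmod (v j)) J.
Proof.
assert (H : forall i, sum_n (fun j => Cmod (shift_coeffs v j)) (S i)
  = sum_n (fun j => Cmod (v j)) i).
{ induction i as [|i IH].
  - rewrite sum_Sn, !sum_O; simpl; rewrite Cmod_0; apply Rplus_0_l.
  - rewrite sum_Sn, IH, sum_Sn; reflexivity. }
destruct J as [|J].
- rewrite !sum_O; simpl; rewrite Cmod_0; apply Cmod_ge_0.
- rewrite H, sum_Sn; unfold plus; simpl; assert (A := Cmod_ge_0 (v (S J))); lra.
Qed.

(** The three-term recurrence propagates [l1] bounds in [n], starting from constant polynomials. *)
Lemma jacobi_coeffs_bounded (z0 c0 c1 : C) (n : Z) :
  (-1 <= n)%Z ->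
  exists B, forall J,
    sum_n (fun j => Cmod (jacobi_coeffs a b z0 c0 c1 n j)) J <= B.
Proof.
assert (H : forall c : C, exists B, forall J,
  sum_n (fun j => Cmod (const_coeffs c j)) J <= B).
{ intros c; exists (Cmod c); induction J as [|J IH].
  - rewrite sum_O; apply Rle_refl.
  - rewrite sum_Sn; unfold plus; simpl; rewrite Cmod_0; lra. }
revert n; apply Z_ind_from_m1; [apply H|apply H|].
intros n Hn [B1 H1] [B2 H2].
set (A1 := Cmod ((z0 - RtoC (b n)) / RtoC (a n))).
set (A2 := Cmod (/ RtoC (a n))).
set (A3 := Cmod (RtoC (a (n - 1)%Z) / RtoC (a n))).
exists (A1 * B2 + A2 * B2 + A3 * B1); intros J.
specialize (H1 J); specialize (H2 J).
assert (P1 : 0 <= A1) by apply Cmod_ge_0; assert (P2 : 0 <= A2) by apply Cmod_ge_0.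
assert (P3 : 0 <= A3) by apply Cmod_ge_0.
apply Rle_trans with (sum_n (fun j =>
  A1 * Cmod (jacobi_coeffs a b z0 c0 c1 n j)
  + A2 * Cmod (shift_coeffs (jacobi_coeffs a b z0 c0 c1 n) j)
  + A3 * Cmod (jacobi_coeffs a b z0 c0 c1 (n - 1) j)) J).
- apply sum_n_le; intros j; rewrite jacobi_coeffs_succ by exact Hn.
  unfold A1, A2, A3, Cminus; rewrite <- !Cmod_mult.
  eapply Rle_trans; [apply Cmod_triangle|rewrite Cmod_opp].
  apply Rplus_le_compat_r, Cmod_triangle.
- rewrite !sum_n_plus_R, !sum_n_scal_R.
  assert (G := shift_coeffs_sum (jacobi_coeffs a b z0 c0 c1 n) J); nra.
Qed.

Lemma wronskian_const (z : C) (u v : Z -> C) (n : Z) :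
  jacobi_solution a b z u -> jacobi_solution a b z v -> (-1 <= n)%Z ->
  wronskian a u v n = wronskian a u v (-1)%Z.
Proof.
intros Hu Hv Hn.
assert (H : forall m, (0 <= m)%Z -> wronskian a u v m = wronskian a u v (m - 1)%Z).
{ intros m Hm; specialize (Hu m Hm); specialize (Hv m Hm); unfold wronskian.
  replace (m - 1 + 1)%Z with m by lia.
  set (A := RtoC (a m)) in *; set (A' := RtoC (a (m - 1)%Z)) in *.
  assert (Eu : (A * u (m + 1)%Z = (z - RtoC (b m)) * u m - A' * u (m - 1)%Z)%C).
  { transitivity ((A' * u (m - 1)%Z + RtoC (b m) * u m + A * u (m + 1)%Z)
      - RtoC (b m) * u m - A' * u (m - 1)%Z)%C; [ring|rewrite Hu; ring]. }
  assert (Ev : (A * v (m + 1)%Z = (z - RtoC (b m)) * v m - A' * v (m - 1)%Z)%C).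
  { transitivity ((A' * v (m - 1)%Z + RtoC (b m) * v m + A * v (m + 1)%Z)
      - RtoC (b m) * v m - A' * v (m - 1)%Z)%C; [ring|rewrite Hv; ring]. }
  transitivity (u m * (A * v (m + 1)%Z) - (A * u (m + 1)%Z) * v m)%C; [ring|].
  rewrite Eu, Ev; ring. }
revert n Hn; apply Z_ind_from_m1.
- reflexivity.
- now rewrite H by lia.
- intros n Hn _ IH; rewrite H by lia.
  now replace (n + 1 - 1)%Z with n by lia.
Qed.

(** From the identity [h_n {u, v} = u_n {h, v} - v_n {h, u}]. *)
Lemma zero_of_wronskians (h u v : Z -> C) (n : Z) :
  wronskian a u v n <> RtoC 0 ->
  wronskian a h u n = RtoC 0 -> wronskian a h v n = RtoC 0 -> (-1 <= n)%Z ->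
  h n = RtoC 0.
Proof.
unfold wronskian; intros W Hu Hv Hn.
assert (A := RtoC_a_neq_0 n Hn).
assert (E : (h n * (RtoC (a n) * (u n * v (n + 1)%Z - u (n + 1)%Z * v n))
  = u n * (RtoC (a n) * (h n * v (n + 1)%Z - h (n + 1)%Z * v n))
    - v n * (RtoC (a n) * (h n * u (n + 1)%Z - h (n + 1)%Z * u n)))%C) by ring.
rewrite Hu, Hv in E.
set (w := (RtoC (a n) * (u n * v (n + 1)%Z - u (n + 1)%Z * v n))%C) in *.
transitivity ((h n * w) / w)%C; [field; exact W|rewrite E; field; exact W].
Qed.

(** * Rescaling of the equation from index [N0] on *)

Variable N0 : nat.

Definition rescale (u : Z -> C) (m : nat) : C :=
  (RtoC (sqrt (a (Z.of_nat (N0 + m)))) * u (Z.of_nat (N0 + m)))%C.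

Definition tail_beta (m : nat) : R := on_nat (beta a b) (N0 + m).

(** The index is [N0 + S m] because the equation with that number determines the rescaled value at
    [S (S m)]; the same holds for [tail_alpha]. *)
Definition tail_kappa (m : nat) : R := / kcoef a (Z.of_nat (N0 + S m)) - 1.

Definition tail_alpha (m : nat) : R :=
  let n := Z.of_nat (N0 + S m) in / (2 * sqrt (a (n - 1)%Z * a n)).

Lemma varkappaE (n : Z) :
  (-1 <= n)%Z -> varkappa a n = sqrt (a (n + 1)%Z) / sqrt (a n).
Proof.
intros Hn; apply sqrt_div_alt, a_pos, Hn.
Qed.

(** Divide the equation with number [n] by [sqrt (a (n - 1))] and insert the rescaled values; with
    [p], [q], [r] the roots of three consecutive [a], one has [k_n = q^2 / (p r)]. *)
Lemma rescale_recurrence (z : C) (w u : Z -> C) :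
  jacobi_with_source a b z w u ->
  perturbed_recurrence tail_beta tail_kappa tail_alpha z (rescale w) (rescale u).
Proof.
intros H m; unfold tail_beta, tail_kappa, tail_alpha, rescale, on_nat, kcoef, beta.
set (n := Z.of_nat (N0 + S m)).
assert (Hn : (0 <= n)%Z) by (unfold n; lia).
replace (Z.of_nat (N0 + S (S m))) with (n + 1)%Z by (unfold n; lia).
replace (Z.of_nat (N0 + m)) with (n - 1)%Z by (unfold n; lia).
rewrite !varkappaE by lia.
replace (n - 1 + 1)%Z with n by lia.
specialize (H n Hn).
assert (a0 := a_pos n ltac:(lia)).
assert (a1 := a_pos (n - 1)%Z ltac:(lia)).
assert (a2 := a_pos (n + 1)%Z ltac:(lia)).
rewrite sqrt_mult by lra.
assert (p0 := sqrt_lt_R0 _ a1); assert (q0 := sqrt_lt_R0 _ a0).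
assert (r0 := sqrt_lt_R0 _ a2).
assert (Ep := sqrt_sqrt _ (Rlt_le _ _ a1)).
assert (Eq := sqrt_sqrt _ (Rlt_le _ _ a0)).
set (p := sqrt (a (n - 1)%Z)) in *; set (q := sqrt (a n)) in *.
set (r := sqrt (a (n + 1)%Z)) in *.
rewrite <- Ep, <- Eq in H.
replace (1 + (/ (q / p / (r / q)) - 1)) with (p * r / (q * q)) by (field; lra).
rewrite ?RtoC_div, ?RtoC_inv, ?RtoC_opp, ?RtoC_mult by nra.
rewrite !RtoC_mult in H.
assert (cp : RtoC p <> RtoC 0) by (apply RtoC_neq_0; lra).
assert (cq : RtoC q <> RtoC 0) by (apply RtoC_neq_0; lra).
assert (cr : RtoC r <> RtoC 0) by (apply RtoC_neq_0; lra).
assert (c2 : RtoC 2 <> RtoC 0) by (apply RtoC_neq_0; lra).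
assert (E : u (n + 1)%Z = ((z * u n + w n - RtoC p * RtoC p * u (n - 1)%Z
   - RtoC (b n) * u n) / (RtoC q * RtoC q))%C).
{ rewrite <- H; field; auto. }
rewrite E; field; auto.
Qed.

Lemma wronskian_rescale (u v : Z -> C) (m : nat) :
  wronskian a u v (Z.of_nat (N0 + m))
  = (RtoC (/ varkappa a (Z.of_nat (N0 + m)))
     * (rescale u m * rescale v (S m) - rescale u (S m) * rescale v m))%C.
Proof.
unfold wronskian, rescale.
replace (Z.of_nat (N0 + S m)) with (Z.of_nat (N0 + m) + 1)%Z by lia.
set (n := Z.of_nat (N0 + m)).
assert (Hn : (0 <= n)%Z) by (unfold n; lia).
rewrite varkappaE by lia.
assert (a0 := a_pos n ltac:(lia)); assert (a2 := a_pos (n + 1)%Z ltac:(lia)).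
assert (q0 := sqrt_lt_R0 _ a0); assert (r0 := sqrt_lt_R0 _ a2).
assert (Eq := sqrt_sqrt _ (Rlt_le _ _ a0)).
set (q := sqrt (a n)) in *; set (r := sqrt (a (n + 1)%Z)) in *.
rewrite <- Eq.
replace (/ (r / q)) with (q / r) by (field; lra).
rewrite RtoC_div, RtoC_mult by lra.
field; apply RtoC_neq_0; lra.
Qed.

Lemma Theta_eq_theta (s : pm) (m : nat) :
  Theta a b N0 s (N0 + m) = theta s tail_beta m.
Proof.
unfold Theta, theta; now replace (N0 + m - N0)%nat with m by lia.
Qed.

End Jacobi.

(** * Limits of amplitudes, their analyticity, and the limit form of the Wronskian *)

Section Asymptotics.

Variables (a b : Z -> R) (beta_inf : R) (N0 : nat) (q : R).
Hypothesis a_pos : forall n : Z, (-1 <= n)%Z -> 0 < a n.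
Hypothesis a_inv_summable : ex_series (fun n : nat => / on_nat a n).
Hypothesis beta_lim : is_lim_seq (on_nat (beta a b)) beta_inf.
Hypothesis beta_inf_lt1 : Rabs beta_inf < 1.
Hypothesis k_ell1 : ell1 (fun n : Z => kcoef a n - 1).
Hypothesis dbeta_ell1 : ell1 (diff (beta a b)).
Hypothesis q1 : q < 1.
Hypothesis beta_le : forall n : nat, (N0 <= n)%nat -> Rabs (on_nat (beta a b) n) <= q.

Let be := tail_beta a b N0.

Lemma tail_beta_le (m : nat) : Rabs (be m) <= q.
Proof. apply beta_le; lia. Qed.

Lemma tail_beta_variation : ex_series (fun m => Rabs (be (S m) - be m)).
Proof.
apply (ex_series_incr_n (V := R_NormedModule) _ N0) in dbeta_ell1.
revert dbeta_ell1; apply ex_series_ext; intros m.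
unfold on_nat, diff, be, tail_beta, on_nat.
now replace (Z.of_nat (N0 + S m)) with (Z.of_nat (N0 + m) + 1)%Z by lia.
Qed.

Lemma tail_alpha_ge_0 (m : nat) : 0 <= tail_alpha a N0 m.
Proof.
unfold tail_alpha; apply Rlt_le, Rinv_0_lt_compat, Rmult_lt_0_compat; [lra|].
apply sqrt_lt_R0, Rmult_lt_0_compat; apply a_pos; lia.
Qed.

(** The geometric mean of two consecutive [1 / a n] is bounded through their sum. *)
Lemma tail_alpha_summable : ex_series (tail_alpha a N0).
Proof.
assert (H0 := proj1 (ex_series_incr_n (V := R_NormedModule) _ N0) a_inv_summable).
assert (H1 := proj1 (ex_series_incr_n (V := R_NormedModule) _ (S N0)) a_inv_summable).
apply (ex_series_le (V := R_CompleteNormedModule) _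
         (fun m => / on_nat a (N0 + m)%nat + / on_nat a (S N0 + m)%nat)).
- intros m; change (norm ?x) with (Rabs x).
  rewrite Rabs_pos_eq by apply tail_alpha_ge_0.
  unfold tail_alpha, on_nat.
  replace (Z.of_nat (N0 + S m) - 1)%Z with (Z.of_nat (N0 + m)) by lia.
  replace (S N0 + m)%nat with (N0 + S m)%nat by lia.
  assert (A := a_pos (Z.of_nat (N0 + m)) ltac:(lia)).
  assert (B := a_pos (Z.of_nat (N0 + S m)) ltac:(lia)).
  rewrite sqrt_mult by lra.
  assert (p0 := sqrt_lt_R0 _ A); assert (r0 := sqrt_lt_R0 _ B).
  rewrite <- (sqrt_sqrt _ (Rlt_le _ _ A)) at 2.
  rewrite <- (sqrt_sqrt _ (Rlt_le _ _ B)) at 2.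
  set (p := sqrt (a (Z.of_nat (N0 + m)))) in *.
  set (r := sqrt (a (Z.of_nat (N0 + S m)))) in *.
  assert (p1 := Rinv_0_lt_compat _ p0); assert (r1 := Rinv_0_lt_compat _ r0).
  rewrite !Rinv_mult; nra.
- exact (ex_series_plus (V := R_NormedModule) _ _ H0 H1).
Qed.

Lemma varkappa_pos (n : Z) : (-1 <= n)%Z -> 0 < varkappa a n.
Proof.
intros Hn; apply sqrt_lt_R0, Rdiv_lt_0_compat; apply a_pos; lia.
Qed.

Lemma tail_kappa_summable : ex_series (fun m => Rabs (tail_kappa a N0 m)).
Proof.
apply (inv_minus_1_summable (fun m => kcoef a (Z.of_nat (N0 + S m)))).
- intros m; apply Rdiv_lt_0_compat; apply varkappa_pos; lia.
- apply (ex_series_incr_n (V := R_NormedModule) _ (S N0)) in k_ell1.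
  revert k_ell1; apply ex_series_ext; intros m; unfold on_nat.
  now replace (S N0 + m)%nat with (N0 + S m)%nat by lia.
Qed.

(** The ratio of consecutive [varkappa] is [kcoef] at the next index, so the sequence [k_ell1] is
    used from index 1. *)
Lemma varkappa_limit :
  exists l : R, 0 < l /\ is_lim_seq (on_nat (varkappa a)) l.
Proof.
apply positive_limit_of_ratios.
- intros n; apply varkappa_pos; lia.
- apply (ex_series_incr_1 (V := R_NormedModule)) in k_ell1.
  revert k_ell1; apply ex_series_ext; intros m; unfold on_nat, kcoef.
  now replace (Z.of_nat (S m) - 1)%Z with (Z.of_nat m) by lia.
Qed.

Let amps (s : pm) (u : Z -> C) : nat -> C := amp s be (rescale a N0 u).

Lemma coeffs_amps_summable (z0 c0 c1 : C) :
  exists e : nat -> R, ex_series e /\ forall s m J,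
    sum_n (fun j => Cmod (amps s (fun n => jacobi_coeffs a b z0 c0 c1 n j) (S m)
                        - amps s (fun n => jacobi_coeffs a b z0 c0 c1 n j) m)) J
    <= e m.
Proof.
set (y := fun j => rescale a N0 (fun n => jacobi_coeffs a b z0 c0 c1 n j)).
assert (Hp : forall j, perturbed_recurrence be (tail_kappa a N0) (tail_alpha a N0)
                         z0 (previous y j) (y j)).
{ intros j m.
  assert (E : previous y j (S m) = rescale a N0
    (fun n => shift_coeffs (jacobi_coeffs a b z0 c0 c1 n) j) (S m)).
  { destruct j; [unfold rescale; simpl; ring|reflexivity]. }
  rewrite E; apply (rescale_recurrence a b a_pos N0 z0 _ _
    (jacobi_coeffs_source a b a_pos z0 c0 c1 j)). }
destruct (jacobi_coeffs_bounded a b z0 c0 c1 (Z.of_nat (N0 + 0)) ltac:(lia))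
  as [B0 H0].
destruct (jacobi_coeffs_bounded a b z0 c0 c1 (Z.of_nat (N0 + 1)) ltac:(lia))
  as [B1 H1].
set (s0 := sqrt (a (Z.of_nat (N0 + 0)))).
set (s1 := sqrt (a (Z.of_nat (N0 + 1)))).
(* [Cmod_amp_le] has the constant [1 / (2 sqrt (1 - q^2))]; adding the two signs doubles it. *)
set (K := / sqrt (1 - q ^ 2)).
assert (K0 : 0 < K) by exact (Rinv_0_lt_compat _ (sqrt_gap_pos be q q1 tail_beta_le)).
assert (s00 : 0 <= s0) by apply sqrt_pos; assert (s10 : 0 <= s1) by apply sqrt_pos.
apply (amp_summable_steps be q q1 tail_beta_le (tail_kappa a N0) (tail_alpha a N0)
         tail_alpha_ge_0 z0 y (K * (s1 * B1 + s0 * B0))); [|exact Hp|].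
- apply step_bound_summable; auto using tail_beta_le, tail_beta_variation,
    tail_alpha_ge_0, tail_alpha_summable, tail_kappa_summable.
- intros J; apply Rle_trans with (sum_n (fun j => K *
    (s1 * Cmod (jacobi_coeffs a b z0 c0 c1 (Z.of_nat (N0 + 1)) j)
     + s0 * Cmod (jacobi_coeffs a b z0 c0 c1 (Z.of_nat (N0 + 0)) j))) J).
  + apply sum_n_le; intros j.
    assert (E0 : Cmod (y j O)
      = s0 * Cmod (jacobi_coeffs a b z0 c0 c1 (Z.of_nat (N0 + 0)) j)).
    { unfold y, rescale; rewrite Cmod_mult, Cmod_R, Rabs_pos_eq; auto. }
    assert (E1 : Cmod (y j 1%nat)
      = s1 * Cmod (jacobi_coeffs a b z0 c0 c1 (Z.of_nat (N0 + 1)) j)).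
    { unfold y, rescale; rewrite Cmod_mult, Cmod_R, Rabs_pos_eq; auto. }
    rewrite <- E0, <- E1; unfold amp_norm.
    assert (A1 := Cmod_amp_le be q q1 tail_beta_le Plus (y j) O).
    assert (A2 := Cmod_amp_le be q q1 tail_beta_le Minus (y j) O).
    unfold Rdiv in A1, A2; rewrite Rinv_mult in A1, A2; fold K in A1, A2; lra.
  + rewrite sum_n_scal_R, sum_n_plus_R, !sum_n_scal_R.
    apply Rmult_le_compat_l; [lra|].
    apply Rplus_le_compat; apply Rmult_le_compat_l; auto.
Qed.

(** The coefficients [P], [Q] of the solution with values [c0] at -1 and [c1] at 0, as functions of
    [z]. *)
Definition amp_limit (s : pm) (c0 c1 z : C) : C :=
  clim (amps s (jacobi_unroll a b z c0 c1)).

(** At fixed [m] an amplitude is a combination, with coefficients free of [z], of two consecutive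
    values of the solution. *)
Lemma amps_coeffs_pseries (s : pm) (z0 c0 c1 t : C) (m : nat) :
  @is_pseries C_AbsRing C_NormedModule
    (fun j => amps s (fun n => jacobi_coeffs a b z0 c0 c1 n j) m) t
    (amps s (jacobi_unroll a b (z0 + t) c0 c1) m).
Proof.
unfold amps, amp, rescale.
set (D := (theta s be m * (zeta s (be m) - zeta (opp_pm s) (be m)))%C).
set (p1 := RtoC (sqrt (a (Z.of_nat (N0 + S m))))).
set (p0 := RtoC (sqrt (a (Z.of_nat (N0 + m))))).
assert (H1 := jacobi_coeffs_pseries a b a_pos z0 c0 c1 t (Z.of_nat (N0 + S m)) ltac:(lia)).
assert (H0 := jacobi_coeffs_pseries a b a_pos z0 c0 c1 t (Z.of_nat (N0 + m)) ltac:(lia)).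
assert (H := is_pseries_linear (p1 / D) (- (zeta (opp_pm s) (be m) * p0 / D)) _ _ _ _ _ H1 H0).
match goal with |- is_pseries _ _ ?l => match type of H with is_pseries _ _ ?l' =>
  replace l with l' by (unfold Cdiv; ring) end end.
revert H; apply (is_pseries_ext (V := C_NormedModule)); intros j.
match goal with |- ?u = ?v => change (@eq C u v) end; unfold Cdiv; ring.
Qed.

(** With [z] itself as centre of expansion, the coefficient of order 0 is the solution, and the
    estimate for [J = 0] gives summable increments. *)
Lemma amp_limit_correct (s : pm) (c0 c1 z : C) :
  Clim (amps s (jacobi_unroll a b z c0 c1)) (amp_limit s c0 c1 z).
Proof.
destruct (coeffs_amps_summable z c0 c1) as [e [He H]].
apply (Clim_of_summable_steps _ e He); intros m.
assert (E : forall i, amps s (jacobi_unroll a b z c0 c1) i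
  = amps s (fun n => jacobi_coeffs a b z c0 c1 n O) i).
{ intros i; apply amp_ext; unfold rescale; rewrite jacobi_coeffs_0; auto; lia. }
rewrite !E; specialize (H s m O); now rewrite sum_O in H.
Qed.

(** Around any [z0] the limits of the Taylor coefficients represent the function in the unit disc,
    where the comparison of partial sums is available. *)
Lemma amp_limit_analytic (s : pm) (c0 c1 : C) : analytic (amp_limit s c0 c1).
Proof.
intros z0; destruct (coeffs_amps_summable z0 c0 c1) as [e [He H]].
exists (mkposreal 1 Rlt_0_1).
exists (fun j => clim (fun m => amps s (fun n => jacobi_coeffs a b z0 c0 c1 n j) m)).
simpl; intros z Hz.
apply (is_pseries_limit _ e He (H s)
         (fun m => amps s (jacobi_unroll a b (z0 + (z - z0)) c0 c1) m)).
- lra.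
- intros m; apply amps_coeffs_pseries.
- replace (z0 + (z - z0))%C with z by ring; apply amp_limit_correct.
Qed.

Lemma beta_limit_pos : 0 < sqrt (1 - beta_inf ^ 2).
Proof.
apply sqrt_lt_R0; apply Rabs_lt_between in beta_inf_lt1; nra.
Qed.

Lemma sqrt_tail_beta_limit :
  is_lim_seq (fun m => sqrt (1 - be m ^ 2)) (sqrt (1 - beta_inf ^ 2)).
Proof.
assert (H : is_lim_seq be beta_inf).
{ apply (is_lim_seq_ext (fun m => on_nat (beta a b) (m + N0)%nat)).
  - intros m; unfold be, tail_beta; now rewrite Nat.add_comm.
  - now apply (is_lim_seq_incr_n (on_nat (beta a b)) N0 beta_inf). }
apply (is_lim_seq_continuous sqrt (fun m => 1 - be m ^ 2)).
- apply continuity_pt_sqrt; apply Rabs_lt_between in beta_inf_lt1; nra.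
- apply is_lim_seq_minus'; [apply is_lim_seq_const|].
  apply (is_lim_seq_ext (fun m => be m * be m)); [intros; ring|].
  replace (beta_inf ^ 2) with (beta_inf * beta_inf) by ring.
  now apply is_lim_seq_mult'.
Qed.

(** The Wronskian is constant, so it equals the limit of its expression through [varkappa], [be] and
    the amplitudes. *)
Lemma wronskian_amp_limits (k : R) (z : C) (u v : Z -> C) (lu lv : pm -> C) (n : Z) :
  0 < k -> is_lim_seq (on_nat (varkappa a)) k ->
  jacobi_solution a b z u -> jacobi_solution a b z v ->
  (forall s, Clim (amps s u) (lu s)) -> (forall s, Clim (amps s v) (lv s)) ->
  (-1 <= n)%Z ->
  wronskian a u v n
  = (RtoC 2 * Ci * RtoC (/ k * sqrt (1 - beta_inf ^ 2))
     * (lu Plus * lv Minus - lu Minus * lv Plus))%C.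
Proof.
intros k0 Hk Hu Hv Lu Lv Hn.
rewrite (wronskian_const a b z) by assumption.
apply (Clim_unique (fun m => wronskian a u v (Z.of_nat (N0 + m)))).
- apply (Clim_ext (fun _ => wronskian a u v (-1)%Z)); [|apply Clim_const].
  intros m; symmetry; apply (wronskian_const a b z); auto; lia.
- apply (Clim_ext (fun m => RtoC 2 * Ci
    * RtoC (/ on_nat (varkappa a) (m + N0)%nat * sqrt (1 - be m ^ 2))
    * (amps Plus u m * amps Minus v m - amps Minus u m * amps Plus v m))%C).
  { intros m; rewrite wronskian_rescale by exact a_pos.
    rewrite (casoratian_amp be q q1 tail_beta_le).
    unfold amps, on_nat; rewrite RtoC_mult, (Nat.add_comm m); ring. }
  apply Clim_mult.
  + apply Clim_scal, Clim_RtoC, is_lim_seq_mult'; [|apply sqrt_tail_beta_limit].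
    apply (is_lim_seq_inv _ k); [|intros E; injection E; lra].
    now apply (is_lim_seq_incr_n (on_nat (varkappa a)) N0 k).
  + apply Clim_minus; apply Clim_mult; auto.
Qed.

(** Rescaling removes [a_n^(-1/2)], so the asymptotics become conditions on two limits, linear
    enough for existence and uniqueness to be algebra. *)
Lemma has_asymptotics_iff (s : pm) (u : Z -> C) :
  has_asymptotics a b N0 s u <-> Clim (amps s u) 1 /\ Clim (amps (opp_pm s) u) 0.
Proof.
assert (p0 : forall m, 0 < sqrt (a (Z.of_nat (N0 + m)))).
{ intros m; apply sqrt_lt_R0, a_pos; lia. }
split.
- intros [eps [He H]]; apply filterlim_C_iff in He.
  apply (asymptotic_amps be q q1 tail_beta_le s _ (fun m => eps (m + N0)%nat)).
  + now apply Clim_incr_n.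
  + intros m; unfold rescale; specialize (H (N0 + S m)%nat ltac:(lia)).
    unfold on_nat in H; rewrite H, Theta_eq_theta, (Nat.add_comm (S m)).
    specialize (p0 (S m)); rewrite RtoC_inv by lra.
    fold be; field; apply RtoC_neq_0; lra.
- intros [H1 H0].
  destruct (amps_asymptotic be q q1 tail_beta_le s _ H1 H0) as [eps [He H]].
  (* Here [eps] is counted from [N0]; the truncated subtraction is exact for [n >= N0]. *)
  exists (fun n => eps (n - N0)%nat); split.
  + apply filterlim_C_iff, (Clim_incr_n _ N0).
    apply (Clim_ext eps); [intros m; f_equal; lia|exact He].
  + intros n Hn; specialize (H (n - N0)%nat); unfold rescale in H.
    specialize (p0 (n - N0)%nat).
    unfold be in H; rewrite <- (Theta_eq_theta a b) in H.
    replace (N0 + (n - N0))%nat with n in * by lia.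
    unfold on_nat; set (p := sqrt (a (Z.of_nat n))) in *.
    rewrite RtoC_inv, <- Cmult_assoc, <- H by lra.
    field; apply RtoC_neq_0; lra.
Qed.

End Asymptotics.

(** * Superposition, conjugation and analyticity of solutions *)

Lemma theta_conj (s : pm) (be : nat -> R) (m : nat) :
  Cconj (theta s be m) = theta (opp_pm s) be m.
Proof.
unfold theta; induction m as [|m IH]; simpl.
- apply injective_projections; simpl; ring.
- now rewrite Cmult_conj, IH, zeta_conj.
Qed.

Lemma jacobi_solution_linear (a b : Z -> R) (z c d : C) (u v : Z -> C) :
  jacobi_solution a b z u -> jacobi_solution a b z v ->
  jacobi_solution a b z (fun n => c * u n + d * v n)%C.
Proof.
intros Hu Hv n Hn; specialize (Hu n Hn); specialize (Hv n Hn).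
transitivity (c * (z * u n) + d * (z * v n))%C; [rewrite <- Hu, <- Hv|]; ring.
Qed.

Lemma jacobi_solution_conj (a b : Z -> R) (z : C) (u : Z -> C) :
  jacobi_solution a b z u -> jacobi_solution a b (Cconj z) (fun n => Cconj (u n)).
Proof.
intros Hu n Hn; specialize (Hu n Hn); apply (f_equal Cconj) in Hu.
assert (R1 : forall x : R, Cconj (RtoC x) = RtoC x)
  by (intros; apply injective_projections; simpl; ring).
now rewrite !Cplus_conj, !Cmult_conj, !R1 in Hu.
Qed.

Lemma has_asymptotics_conj (a b : Z -> R) (N0 : nat) (s : pm) (u : Z -> C) :
  has_asymptotics a b N0 s u ->
  has_asymptotics a b N0 (opp_pm s) (fun n => Cconj (u n)).
Proof.
assert (R1 : forall x : R, Cconj (RtoC x) = RtoC x)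
  by (intros; apply injective_projections; simpl; ring).
intros [eps [He H]]; exists (fun n => Cconj (eps n)); split.
- apply filterlim_C_iff in He; apply filterlim_C_iff.
  revert He; apply is_lim_seq_ext; intros n.
  rewrite <- Cmod_conj, Cminus_conj, R1; reflexivity.
- intros n Hn; unfold on_nat in *; rewrite (H n Hn).
  rewrite !Cmult_conj, Cplus_conj, !R1; do 2 f_equal.
  exact (theta_conj s (tail_beta a b N0) (n - N0)).
Qed.

(** Dividing by the nonzero [a n], each new value is affine in [z] with the two previous values as
    factors, so analyticity spreads from the indices -1 and 0. *)
Lemma jacobi_solutions_analytic (a b : Z -> R) (f : C -> Z -> C) :
  (forall n : Z, (-1 <= n)%Z -> 0 < a n) ->
  (forall z, jacobi_solution a b z (f z)) ->
  analytic (fun z => f z (-1)%Z) -> analytic (fun z => f z 0%Z) ->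
  forall n, (-1 <= n)%Z -> analytic (fun z => f z n).
Proof.
intros a_pos Hf Hm1 H0; apply Z_ind_from_m1; [exact Hm1|exact H0|].
intros n Hn IH1 IH2.
assert (A := RtoC_a_neq_0 a a_pos n ltac:(lia)).
apply (analytic_ext (fun z => / RtoC (a n) * (z * f z n)
  + 1 * (- (RtoC (b n) / RtoC (a n)) * f z n
         + - (RtoC (a (n - 1)%Z) / RtoC (a n)) * f z (n - 1)%Z))%C).
- intros z; specialize (Hf z n Hn); rewrite <- Hf; field; exact A.
- apply analytic_linear; [now apply analytic_mult_id|now apply analytic_linear].
Qed.

(** * Construction of the two solutions from their amplitude limits *)

Theorem theorem7p2 (a b : Z -> R) (beta_inf : R) (N0 : nat)
  (a_pos : forall n : Z, (-1 <= n)%Z -> 0 < a n)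
  (a_inv_summable : ex_series (fun n : nat => / on_nat a n))
  (a_infty : is_lim_seq (on_nat a) p_infty)
  (beta_lim : is_lim_seq (on_nat (beta a b)) beta_inf)
  (beta_inf_lt1 : Rabs beta_inf < 1)
  (k_ell1 : ell1 (fun n : Z => kcoef a n - 1))
  (dbeta_ell1 : ell1 (diff (beta a b)))
  (N0_sep : exists q : R, q < 1 /\
     forall n : nat, (N0 <= n)%nat -> Rabs (on_nat (beta a b) n) <= q) :
  exists varkappa_inf : R,
    is_lim_seq (on_nat (varkappa a)) varkappa_inf /\
    exists f : pm -> C -> Z -> C,
      (forall (s : pm) (z : C),
         jacobi_solution a b z (f s z) /\
         has_asymptotics a b N0 s (f s z) /\
         (forall g : Z -> C,
            jacobi_solution a b z g -> has_asymptotics a b N0 s g ->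
            forall n : Z, (-1 <= n)%Z -> g n = f s z n)) /\
      (forall (z : C) (n : Z), (-1 <= n)%Z ->
         f Minus (Cconj z) n = Cconj (f Plus z n)) /\
      (forall (z : C) (n : Z), (-1 <= n)%Z ->
         wronskian a (f Plus z) (f Minus z) n
         = (RtoC 2 * Ci * RtoC (/ varkappa_inf * sqrt (1 - beta_inf ^ 2)))%C) /\
      (RtoC 2 * Ci * RtoC (/ varkappa_inf * sqrt (1 - beta_inf ^ 2)))%C <> RtoC 0 /\
      (forall z : C, lin_indep (f Plus z) (f Minus z)) /\
      (forall (s : pm) (n : nat),
         analytic (fun z : C => f s z (Z.of_nat n))).
Proof.
destruct N0_sep as [q [q1 beta_le]].
destruct (varkappa_limit a a_pos k_ell1) as [k [k0 Hk]].
exists k; split; [exact Hk|].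
set (Winf := (RtoC 2 * Ci * RtoC (/ k * sqrt (1 - beta_inf ^ 2)))%C).
assert (W0 : Winf <> RtoC 0).
{ assert (r0 := beta_limit_pos beta_inf beta_inf_lt1).
  assert (ik := Rinv_0_lt_compat _ k0).
  repeat apply Cmult_neq_0; try (apply RtoC_neq_0; nra).
  apply Cmod_gt_0; rewrite Cmod_Ci; lra. }
set (A s u := amp s (tail_beta a b N0) (rescale a N0 u)).
assert (A_linear : forall s c d u v m,
  A s (fun n => c * u n + d * v n)%C m = (c * A s u m + d * A s v m)%C).
{ intros s c d u v m; unfold A; rewrite <- amp_linear.
  apply amp_ext; unfold rescale; ring. }
assert (Wlim : forall z u v lu lv n,
  jacobi_solution a b z u -> jacobi_solution a b z v ->
  (forall s, Clim (A s u) (lu s)) -> (forall s, Clim (A s v) (lv s)) ->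
  (-1 <= n)%Z ->
  wronskian a u v n = (Winf * (lu Plus * lv Minus - lu Minus * lv Plus))%C).
{ intros; eapply (wronskian_amp_limits a b beta_inf N0 q); eauto. }
assert (asym : forall s u,
  has_asymptotics a b N0 s u <-> Clim (A s u) 1 /\ Clim (A (opp_pm s) u) 0)
  by (intros; apply (has_asymptotics_iff a b N0 q); assumption).
set (phi := fun z => jacobi_unroll a b z 1 0).
set (psi := fun z => jacobi_unroll a b z 0 1).
set (Lphi := fun s z => amp_limit a b N0 s 1 0 z).
set (Lpsi := fun s z => amp_limit a b N0 s 0 1 z).
assert (Hphi : forall s z, Clim (A s (phi z)) (Lphi s z))
  by (intros; apply (amp_limit_correct a b N0 q); assumption).
assert (Hpsi : forall s z, Clim (A s (psi z)) (Lpsi s z))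
  by (intros; apply (amp_limit_correct a b N0 q); assumption).
assert (Sphi : forall z, jacobi_solution a b z (phi z))
  by (intros; now apply jacobi_unroll_solution).
assert (Spsi : forall z, jacobi_solution a b z (psi z))
  by (intros; now apply jacobi_unroll_solution).
(* [phi] and [psi] have Wronskian [a (-1)], read off at index -1; the limit form equates it to
   [Winf] times the determinant of their amplitude limits, which is thus the nonzero constant
   [D]. *)
set (D := (RtoC (a (-1)%Z) / Winf)%C).
assert (D0 : D <> RtoC 0).
{ intros E; apply (RtoC_a_neq_0 a a_pos (-1)); [lia|].
  transitivity (D * Winf)%C; [unfold D; field; exact W0|rewrite E; ring]. }
assert (HD : forall z,
  (Lphi Plus z * Lpsi Minus z - Lphi Minus z * Lpsi Plus z)%C = D).
{ intros z.
  assert (E := Wlim z (phi z) (psi z) (fun s => Lphi s z) (fun s => Lpsi s z) (-1)%Z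
    (Sphi z) (Spsi z) (fun s => Hphi s z) (fun s => Hpsi s z) (Z.le_refl _)).
  assert (E' : wronskian a (phi z) (psi z) (-1) = RtoC (a (-1)%Z)).
  { unfold wronskian, phi, psi, jacobi_unroll, unroll; simpl; ring. }
  rewrite E' in E; unfold D; rewrite E; field; exact W0. }
(* Cramer's rule for amplitude limits 1 at [s] and 0 at the opposite sign; [sgn s] is the
   orientation of the determinant. *)
set (f := fun s z n => (RtoC (sgn s) / D * Lpsi (opp_pm s) z * phi z n
                        + - (RtoC (sgn s) / D * Lphi (opp_pm s) z) * psi z n)%C).
assert (Sf : forall s z, jacobi_solution a b z (f s z))
  by (intros; now apply jacobi_solution_linear).
assert (Lf : forall s' s z, Clim (A s' (f s z))
  (RtoC (sgn s) / D * Lpsi (opp_pm s) z * Lphi s' z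
   + - (RtoC (sgn s) / D * Lphi (opp_pm s) z) * Lpsi s' z)).
{ intros s' s z; eapply Clim_ext; [intros m; symmetry; apply A_linear|].
  apply Clim_plus; apply Clim_scal; auto. }
assert (Lf1 : forall s z, Clim (A s (f s z)) 1).
{ intros s z.
  replace (RtoC 1) with (RtoC (sgn s) / D * Lpsi (opp_pm s) z * Lphi s z
   + - (RtoC (sgn s) / D * Lphi (opp_pm s) z) * Lpsi s z)%C; [apply Lf|].
  transitivity ((Lphi Plus z * Lpsi Minus z - Lphi Minus z * Lpsi Plus z) / D)%C.
  - destruct s; simpl; unfold Cdiv; [ring|].
    change (-1) with (Ropp 1); rewrite RtoC_opp; ring.
  - rewrite HD; field; exact D0. }
assert (Lf0 : forall s z, Clim (A (opp_pm s) (f s z)) 0).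
{ intros s z.
  replace (RtoC 0) with (RtoC (sgn s) / D * Lpsi (opp_pm s) z * Lphi (opp_pm s) z
   + - (RtoC (sgn s) / D * Lphi (opp_pm s) z) * Lpsi (opp_pm s) z)%C; [apply Lf|].
  unfold Cdiv; ring. }
assert (Wf : forall z n, (-1 <= n)%Z -> wronskian a (f Plus z) (f Minus z) n = Winf).
{ intros z n Hn.
  rewrite (Wlim z _ _ (fun s => match s with Plus => RtoC 1 | Minus => RtoC 0 end)
    (fun s => match s with Plus => RtoC 0 | Minus => RtoC 1 end)); auto; [ring| |].
  - intros []; [apply Lf1|apply (Lf0 Plus)].
  - intros []; [apply (Lf0 Minus)|apply Lf1]. }
(* The difference [h] of two candidates has zero amplitude limits, so its Wronskians with [f Plus z]
   and [f Minus z] vanish, and these two solutions have Wronskian [Winf]. *)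
assert (Uf : forall s z g, jacobi_solution a b z g -> has_asymptotics a b N0 s g ->
  forall n, (-1 <= n)%Z -> g n = f s z n).
{ intros s z g Hg Ag n Hn; apply asym in Ag; destruct Ag as [Ag1 Ag0].
  set (h := fun n => (1 * g n + (- (1)) * f s z n)%C).
  assert (Sh : jacobi_solution a b z h) by now apply jacobi_solution_linear.
  assert (Lh : forall s', Clim (A s' h) 0).
  { intros s'; eapply Clim_ext; [intros m; symmetry; apply A_linear|].
    assert (G : exists l, Clim (A s' g) l /\ Clim (A s' (f s z)) l).
    { destruct s, s'; [exists (RtoC 1)|exists (RtoC 0)|exists (RtoC 0)|exists (RtoC 1)];
        split; auto; [apply (Lf0 Plus)|apply (Lf0 Minus)]. }
    destruct G as [l [G1 G2]].
    replace (RtoC 0) with (1 * l + - (1) * l)%C by ring.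
    apply Clim_plus; now apply Clim_scal. }
  assert (Wh : forall s', wronskian a h (f s' z) n = RtoC 0).
  { intros s'.
    rewrite (Wlim z h _ (fun _ => RtoC 0) _ n Sh (Sf s' z) Lh (fun s => Lf s s' z) Hn).
    ring. }
  assert (Zh : h n = RtoC 0).
  { apply (zero_of_wronskians a a_pos h (f Plus z) (f Minus z)); auto.
    now rewrite Wf. }
  unfold h in Zh.
  transitivity ((1 * g n + - (1) * f s z n) + f s z n)%C; [ring|rewrite Zh; ring]. }
assert (Af : forall s z, has_asymptotics a b N0 s (f s z))
  by (intros; apply asym; auto).
(* [c0'] and [c1'] stand for the values of [phi] and [psi] at one of the initial indices, which do
   not depend on [z]. *)
assert (analytic_comb : forall s c0 c1 c0' c1',
  analytic (fun z => RtoC (sgn s) / D * amp_limit a b N0 (opp_pm s) c0 c1 z * c0'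
    + - (RtoC (sgn s) / D * amp_limit a b N0 (opp_pm s) c1 c0 z) * c1')%C).
{ intros s c0 c1 c0' c1'.
  eapply analytic_ext; [|apply (analytic_linear (RtoC (sgn s) / D * c0')
    (- (RtoC (sgn s) / D * c1')) (amp_limit a b N0 (opp_pm s) c0 c1)
    (amp_limit a b N0 (opp_pm s) c1 c0));
    apply (amp_limit_analytic a b N0 q); assumption].
  intros z; cbv beta; ring. }
exists f; split; [intros s z; split; [apply Sf|split; [apply Af|apply Uf]]|].
split; [|split; [exact Wf|split; [exact W0|split]]].
(* The conjugate of [f Plus z] solves the equation at [Cconj z] with the asymptotics of [Minus], so
   uniqueness identifies it. *)
- intros z n Hn; symmetry.
  apply (Uf Minus (Cconj z) (fun n => Cconj (f Plus z n))); auto.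
  + now apply jacobi_solution_conj.
  + now apply (has_asymptotics_conj a b N0 Plus).
- intros z c d H.
  assert (Hn : (-1 <= -1)%Z) by lia.
  assert (E1 := H (-1)%Z Hn); assert (E2 := H (-1 + 1)%Z ltac:(lia)).
  assert (W := Wf z (-1)%Z Hn); unfold wronskian in W.
  set (u := f Plus z) in *; set (v := f Minus z) in *.
  (* [c * Winf] is the Wronskian of the vanishing combination with [v]; likewise [d * Winf] arises
     from the Wronskian of [u] with it. *)
  assert (Ec : (c * Winf)%C = RtoC 0).
  { rewrite <- W.
    transitivity (RtoC (a (-1)%Z) * ((c * u (-1)%Z + d * v (-1)%Z) * v (-1 + 1)%Z
      - (c * u (-1 + 1)%Z + d * v (-1 + 1)%Z) * v (-1)%Z))%C; [ring|].
    rewrite E1, E2; ring. }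
  assert (Ed : (d * Winf)%C = RtoC 0).
  { rewrite <- W.
    transitivity (RtoC (a (-1)%Z) * ((c * u (-1 + 1)%Z + d * v (-1 + 1)%Z) * u (-1)%Z
      - (c * u (-1)%Z + d * v (-1)%Z) * u (-1 + 1)%Z))%C; [ring|].
    rewrite E1, E2; ring. }
  split; [transitivity (c * Winf / Winf)%C|transitivity (d * Winf / Winf)%C];
    try (field; exact W0); [rewrite Ec|rewrite Ed]; field; exact W0.
- intros s n.
  apply (jacobi_solutions_analytic a b (f s) a_pos (Sf s)); [| |lia].
  (* The first pair of arguments selects the amplitude limit of [psi]; the second gives [phi] and
     [psi] at -1, and in the next case at 0. *)
  + exact (analytic_comb s 0 1 1 0)%C.
  + exact (analytic_comb s 0 1 0 1)%C.
Qed.
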